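(* For all integers $q,r\ge 1$, on the random model $(\Omega_n,P_n)$, \[ \sqrt{n}\left(\frac{S_{q+r,n}}{S_{q,n}}-\frac{1}{4^r}\right)\Rightarrow N\left(0,\,\frac{4^r-1}{3\cdot 4^{2r-q+1}}\right)\qquad(n\to\infty), \] where $\Rightarrow$ denotes convergence in distribution and $N(\mu,\sigma^2)$ is the normal distribution with mean $\mu$ and variance $\sigma^2$.
   Context: For $n\ge 1$, let $\Omega_n$ be the set of rooted plane (ordered) full binary trees with $n$ leaves (every internal node has exactly two children, left and right distinguished). The random model is $\Omega_n$ with the uniform probability measure $P_n$. Horton–Strahler ordering: every leaf has order 1; an internal node whose two children have different orders $r_1\neq r_2$ has order $\max\{r_1,r_2\}$; an internal node whose two children both have order $r$ has order $r+1$. A branch of order $r$ is a maximal connected path consisting of nodes all of order $r$. For $\tau\in\Omega_n$, $S_{r,n}(\tau)$ denotes the number of branches of order $r$ in $\tau$. The ratio $S_{q+r,n}/S_{q,n}$ is taken to be $0$ when $S_{q,n}=0$. *)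

(* Defs.v *)
From HB Require Import structures.
From mathcomp Require Import all_boot all_order all_algebra.
From mathcomp Require Import all_classical all_reals all_analysis.
From mathcomp Require Import normal_distribution.
Set Implicit Arguments.
Unset Strict Implicit.
Unset Printing Implicit Defensive.
Import Order.TTheory GRing.Theory Num.Theory.
Local Open Scope ring_scope.

Inductive btree : Type := Leaf | Node of btree & btree.

Fixpoint leaves (t : btree) : nat :=
  match t with Leaf => 1 | Node a b => leaves a + leaves b end.

Fixpoint hs_order (t : btree) : nat :=
  match t with
  | Leaf => 1
  | Node a b =>
      let x := hs_order a in let y := hs_order b in
      if x == y then x.+1 else maxn x y
  end.

(* Each branch of order k (maximal connected path of nodes of order k) has a
   unique top node: a node of order k whose parent does not have order k (or
   which is the root).  [tops k pk t] counts such nodes in t, where pk is the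
   order of the parent of the root of t (0 = no parent; orders are >= 1). *)
Fixpoint tops (k pk : nat) (t : btree) : nat :=
  ((hs_order t == k) && (pk != k)) +
  match t with
  | Leaf => 0
  | Node a b => tops k (hs_order t) a + tops k (hs_order t) b
  end.

Definition nbranches (k : nat) (t : btree) : nat := tops k 0 t.

(* Enumeration of all trees with n leaves (each exactly once); fuel bounds
   the recursion depth. *)
Fixpoint trees_fuel (fuel n : nat) : seq btree :=
  match fuel with
  | 0 => [::]
  | f.+1 =>
      if (n == 1)%N then [:: Leaf]
      else flatten [seq [seq Node a b | a <- trees_fuel f k, b <- trees_fuel f (n - k)]
                   | k <- iota 1 n.-1]
  end.

Definition Omega (n : nat) : seq btree := trees_fuel n n.

Definition unifP {R : realType} (n : nat) (E : pred btree) : R :=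
  (count E (Omega n))%:R / (size (Omega n))%:R.

Definition branch_ratio {R : realType} (q r : nat) (t : btree) : R :=
  if (nbranches q t == 0)%N then 0
  else (nbranches (q + r) t)%:R / (nbranches q t)%:R.

(* Main.v *)
(**
  Pruning a tree (deleting its leaves and contracting the resulting unary nodes)
  lowers all orders by one, so that [S_(k+1)(t) = S_k(prune t)].  The number of
  trees with [n] leaves that prune to a given [s] depends only on the number of
  leaves of [s]; hence, given [M = leaves (prune t)], the tree [prune t] is
  uniform, and [S_1, S_2, ...] is a Markov chain.

  The weights of the law of [M] satisfy a two-term recursion, which is an exact
  discrete Stein identity; together with bounds on the solution of Stein's
  equation it gives [(4 M - n) / sqrt n => N(0, 1)] with an error that is
  [O(1 / sqrt n)] uniformly over bounded Lipschitz test functions.  Writing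
  [n] for the number of leaves of [t], the statistic
  [Y_(q,r) = sqrt n (S_(q+r) / S_q - 4^-r)] satisfies
     Y_(1,r+1)(t) = 4^-(r+1) (4 M - n) / sqrt n + sqrt (M / n) Y_(1,r)(prune t),
     Y_(q+1,r)(t) = sqrt (n / M) Y_(q,r)(prune t),
  so asymptotic normality propagates along the chain by conditioning on [M] and
  convolving Gaussians.
*)
Require Import Defs.
From HB Require Import structures.
From mathcomp Require Import all_boot all_order all_algebra.
From mathcomp Require Import all_classical all_reals all_analysis.
From mathcomp Require Import normal_distribution.
From mathcomp Require Import measurable_realfun zify ring lra.
Import Order.TTheory GRing.Theory Num.Theory.
Import numFieldNormedType.Exports.

Set Implicit Arguments.
Unset Strict Implicit.
Unset Printing Implicit Defensive.

(** * Pruning and the enumeration of trees *)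

Lemma leaves_gt0 t : 0 < leaves t.
Proof. by elim: t => //= a Ha b Hb; lia. Qed.

Lemma hs_order_gt0 t : 0 < hs_order t.
Proof. by elim: t => //= a Ha b Hb; case: ifP => //; lia. Qed.

(** The middle cases contract a node left unary by the deletion. Pruning [Leaf] would give the empty
    tree; the value [Leaf] is a default, hence the later hypotheses that exclude leaves. *)
Fixpoint prune (t : btree) : btree :=
  match t with
  | Leaf => Leaf
  | Node Leaf Leaf => Leaf
  | Node Leaf b => prune b
  | Node a Leaf => prune a
  | Node a b => Node (prune a) (prune b)
  end.

Arguments prune : simpl never.

Definition is_leaf (t : btree) := if t is Leaf then true else false.

Lemma is_leafE t : is_leaf t = (leaves t == 1).
Proof.
case: t => //= a b; have := leaves_gt0 a; have := leaves_gt0 b.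
by move=> *; apply/esym/eqP; lia.
Qed.

Lemma pruneE a b : prune (Node a b) =
  if is_leaf a then prune b else if is_leaf b then prune a
  else Node (prune a) (prune b).
Proof. by case: a => //; case: b. Qed.

Lemma hs_order_leaf t : is_leaf t -> hs_order t = 1.
Proof. by case: t. Qed.

(** A leaf beside a non-leaf has the smaller order, so it does not affect the order of its parent
    and contracting that parent is harmless; a node with two leaves has order 2 and becomes a
    leaf. *)
Lemma hs_order_prune t : ~~ is_leaf t -> hs_order t = (hs_order (prune t)).+1.
Proof.
elim: t => // a IHa b IHb _; rewrite pruneE /=.
case: (boolP (is_leaf a)) => la.
  rewrite (hs_order_leaf la); case: (boolP (is_leaf b)) => lb.
    by move: lb; case: b IHb.
  rewrite (IHb lb); have := hs_order_gt0 (prune b).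
  by case: eqP => //; lia.
rewrite (IHa la); case: (boolP (is_leaf b)) => lb.
  rewrite (hs_order_leaf lb); have := hs_order_gt0 (prune a).
  by case: eqP => //; lia.
by rewrite (IHb lb) /= eqSS maxnSS; case: ifP.
Qed.

Lemma tops_node k pk a b : tops k pk (Node a b) =
  ((hs_order (Node a b) == k) && (pk != k)) +
  (tops k (hs_order (Node a b)) a + tops k (hs_order (Node a b)) b).
Proof. by []. Qed.

Lemma tops_leaf k pk t : is_leaf t -> 1 < k -> tops k pk t = 0.
Proof. by case: t => //= _; rewrite addn0; case: k => [|[]]. Qed.

(* A node and its pruned image have orders differing by one, so the test on the
   parent's order is transported as long as the parent survives or, when it is
   contracted, has the same order as its surviving child. *)
Lemma tops_prune k pk t : 0 < k -> ~~ is_leaf t ->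
  tops k.+1 pk.+1 t = tops k pk (prune t).
Proof.
move=> k0; elim: t pk => // a IHa b IHb pk _.
have ho : hs_order (Node a b) = (hs_order (prune (Node a b))).+1.
  exact: hs_order_prune.
rewrite tops_node ho eqSS eqSS.
rewrite pruneE in ho *.
have idem s p : ((hs_order s == k) && (p != k)) + tops k (hs_order s) s
    = tops k p s.
  by case: s => /= *; [rewrite addn0|]; case: eqP => //= ->; lia.
case: (boolP (is_leaf a)) => la.
  rewrite (tops_leaf _ la) ?ltnS// add0n.
  case: (boolP (is_leaf b)) => lb.
    rewrite (tops_leaf _ lb) ?ltnS//.
    by move: lb; case: b {IHb ho} => //= _.
  by rewrite IHb//.
case: (boolP (is_leaf b)) => lb.
  by rewrite (tops_leaf _ lb) ?ltnS// addn0 IHa.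
by rewrite IHa// IHb// -tops_node.
Qed.

Lemma nbranchesS k t : 0 < k -> ~~ is_leaf t ->
  nbranches k.+1 t = nbranches k (prune t).
Proof.
(* Here the marker for a missing parent changes from 0 to 1; both differ from [k.+1 >= 2], so the
   root is counted alike. *)
move=> k0 lt; rewrite -[RHS](tops_prune 0 k0 lt) /nbranches.
by case: t lt => //= a b _; case: k k0.
Qed.

Lemma nbranches1 t : nbranches 1 t = leaves t.
Proof.
rewrite /nbranches; suff: forall pk, pk != 1 -> tops 1 pk t = leaves t by apply.
elim: t => [pk /= ->//|a IHa b IHb pk pk1].
have ho : hs_order (Node a b) != 1.
  rewrite hs_order_prune//; have := hs_order_gt0 (prune (Node a b)).
  by case: hs_order.
by rewrite tops_node (negbTE ho) IHa// IHb.
Qed.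

(** * Enumeration of trees and the fibers of pruning *)

Lemma trees_fuel_leq f g n : n <= f -> n <= g ->
  trees_fuel f n = trees_fuel g n.
Proof.
elim: f g n => [|f IH] [|g] n //=; rewrite ?leqn0.
- by move=> /eqP-> _.
- by move=> _ /eqP->.
move=> nf ng; case: ifP => // n1; congr flatten; apply/eq_in_map => k.
rewrite mem_iota => /andP[k1 k2].
by rewrite (IH g k) ?(IH g (n - k))//; lia.
Qed.

Lemma Omega1 : Omega 1 = [:: Leaf]. Proof. by []. Qed.

Lemma big_OmegaS (V : nmodType) n (F : btree -> V) :
  (\sum_(t <- Omega n.+2) F t = \sum_(k < n.+1)
    \sum_(a <- Omega k.+1) \sum_(b <- Omega (n.+1 - k)) F (Node a b))%R.
Proof.
have -> : Omega n.+2 = flatten [seq [seq Node a b | a <- trees_fuel n.+1 k,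
   b <- trees_fuel n.+1 (n.+2 - k)] | k <- iota 1 n.+1] by [].
rewrite big_flatten big_map.
rewrite -(big_mkord xpredT (fun k => \sum_(a <- Omega k.+1)
   \sum_(b <- Omega (n.+1 - k)) F (Node a b))%R).
rewrite /index_iota subn0 (iotaDl 1 0) big_map.
rewrite [LHS]big_seq [RHS]big_seq; apply: eq_bigr => k; rewrite mem_iota => kn.
rewrite big_allpairs_dep.
rewrite (trees_fuel_leq (g := k.+1)) 1?(trees_fuel_leq (n := n.+2 - k.+1) (g := n.+1 - k)) //; lia.
Qed.

(** This expresses that [Omega n] holds only trees with [n] leaves, in a form that needs no
    membership predicate on trees. *)
Lemma big_Omega_leaves (V : nmodType) n (F : nat -> btree -> V) :
  (\sum_(t <- Omega n) F (leaves t) t = \sum_(t <- Omega n) F n t)%R.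
Proof.
elim/ltn_ind: n F => -[|[|n]] IH F; rewrite ?big_nil// ?Omega1 ?big_seq1//.
rewrite !big_OmegaS; apply: eq_bigr => k _.
have kn := ltn_ord k.
rewrite (IH k.+1 _ (fun l a => \sum_(b <- Omega (n.+1 - k))
  F (l + leaves b) (Node a b))%R) ?ltnS//.
apply: eq_bigr => a _.
rewrite (IH (n.+1 - k) _ (fun l b => F (k.+1 + l) (Node a b))); last by lia.
by apply: eq_bigr => b _; congr F; lia.
Qed.

(** A Vandermonde identity: subsets of size [a + b + 1] of [m + 1] points, classified by the
    position [k] of their element of rank [a + 1]. *)
Lemma sum_binM m a b :
  \sum_(k < m.+1) 'C(k, a) * 'C(m - k, b) = 'C(m.+1, (a + b).+1).
Proof.
elim: m b => [|m IH] b.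
  by rewrite big_ord1 binS !bin0n; case: a b => [|a] [|b].
case: b => [|b].
  rewrite big_ord_recr /= subnn !bin0 muln1 addn0 [RHS]binS.
  have := IH 0; rewrite addn0 => <-; congr (_ + _).
  by apply: eq_bigr => k _; rewrite !bin0.
rewrite big_ord_recr /= subnn bin0n muln0 addn0 addnS [RHS]binS.
have := IH b.+1; rewrite addnS => <-; rewrite -IH -big_split /=; apply: eq_bigr => k _.
by rewrite subSn ?binS ?mulnDr// -ltnS.
Qed.

Lemma big_antidiag (V : nmodType) N p (T : nat -> nat -> V) : p < N ->
  (\sum_(i < p.+1) T i (p - i)%N =
   \sum_(i < N) \sum_(j < N | (i + j == p)%N) T i j)%R.
Proof.
move=> pN.
rewrite (big_ord_widen N (fun i => T i (p - i)%N))// big_mkcond.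
apply: eq_bigr => i _; case: ltnP => ip.
  rewrite (big_pred1 (Ordinal (leq_ltn_trans (leq_subr i p) pN)))// => j.
  by apply/eqP/eqP => [?|->/=]; [apply: val_inj => /=|]; lia.
by rewrite big_pred0// => j; apply/eqP; lia.
Qed.

(** Number of trees with [n + 2] leaves that prune to a given [s] with [i + 1] leaves. The leaves of
    [s] become cherries; the other [n - 2 i] leaves are spread over the [2 i + 1] edges of [s] (root
    edge included), each on one of two sides. *)
Definition fiber_size (n i : nat) := 'C(n, i.*2) * 2 ^ (n - i.*2).

Lemma fiber_size_small n i : n < i.*2 -> fiber_size n i = 0.
Proof. by move=> ni; rewrite /fiber_size bin_small. Qed.

(** Number of pairs of non-leaf trees with [m + 4] leaves in all that prune to a given pair with
    [p + 2] leaves in all. *)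
Definition fiber_conv (m p : nat) := 'C(m.+1, p.*2.+1) * 2 ^ (m - p.*2).

Lemma sum_fiber_sizeM m i l :
  \sum_(j < m.+1) fiber_size j i * fiber_size (m - j) l = fiber_conv m (i + l).
Proof.
rewrite /fiber_conv doubleD -sum_binM big_distrl /=; apply: eq_bigr => j _.
have jm := ltn_ord j; rewrite /fiber_size.
have [ji|ji] := ltnP j i.*2; first by rewrite bin_small.
have [jl|jl] := ltnP (m - j) l.*2; first by rewrite (bin_small jl) !(muln0,mul0n).
by rewrite mulnACA -expnD; congr (_ * 2 ^ _); lia.
Qed.

Lemma fiber_size_rec0 n : fiber_size n.+1 0 = 2 * fiber_size n 0.
Proof. by rewrite /fiber_size !bin0 !mul1n !subn0 expnS. Qed.

(** Pascal's rule, read as a case split at the root: one child is a leaf, on either side, or neither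
    child is. *)
Lemma fiber_size_recS m p :
  fiber_size m.+2 p.+1 = 2 * fiber_size m.+1 p.+1 + fiber_conv m p.
Proof.
rewrite /fiber_size /fiber_conv doubleS binS mulnDl.
rewrite !subSS; congr (_ + _).
have [mp|mp] := ltnP m.+1 p.*2.+2; first by rewrite bin_small.
by rewrite mulnCA -expnS; congr (_ * 2 ^ _); lia.
Qed.

Lemma eq_big_Omega2 (V : nmodType) n (F G : btree -> V) :
  (forall a b, F (Node a b) = G (Node a b)) ->
  (\sum_(t <- Omega n.+2) F t = \sum_(t <- Omega n.+2) G t)%R.
Proof.
move=> FG; rewrite !big_OmegaS; apply: eq_bigr => k _.
by apply: eq_bigr => a _; apply: eq_bigr => b _.
Qed.

Lemma prune_leafr a : prune (Node a Leaf) = prune a.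
Proof. by case: a. Qed.

Lemma prune_leafl b : prune (Node Leaf b) = prune b.
Proof. by case: b. Qed.

(* The preimages of [s] under pruning are obtained by subdividing its edges (and
   the edge above the root) by leaf-carrying nodes; their number depends on [s]
   only through its size. *)
Lemma big_Omega_prune (V : nmodType) n (F : btree -> V) :
  (\sum_(t <- Omega n.+2) F (prune t) =
   \sum_(i < n.+1) (\sum_(s <- Omega i.+1) F s) *+ fiber_size n i)%R.
Proof.
elim/ltn_ind: n F => -[|n] IH F.
  by rewrite big_OmegaS !big_ord1 Omega1 !big_seq1.
(* The first and last terms have a leaf as left or right child and together give twice the sum for
   one leaf less; the middle terms have two non-leaf children. *)
rewrite big_OmegaS big_ord_recl big_ord_recr /= subn0 Omega1 big_seq1.
rewrite /bump /= add1n (_ : n.+2 - n.+1 = 1)%N ?subSnn// Omega1.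
under [X in (_ + (_ + X))%R]eq_bigr do rewrite big_seq1 prune_leafr.
under eq_bigr do rewrite prune_leafl.
rewrite (IH n)// addrCA -mulr2n.
case: n IH => [|m] IH.
  rewrite big_ord0 add0r !big_ord_recl !big_ord0 /= !addr0 -mulrnA.
  by [].
pose T i j : V := (\sum_(s <- Omega i.+1) \sum_(u <- Omega j.+1) F (Node s u))%R.
have -> : (\sum_(j < m.+1) \sum_(a <- Omega (1 + j).+1)
    \sum_(b <- Omega (m.+3 - (1 + j))) F (prune (Node a b)) =
    \sum_(i < m.+2) \sum_(l < m.+2) T i l *+ fiber_conv m (i + l))%R.
  transitivity (\sum_(j < m.+1) \sum_(i < m.+2) \sum_(l < m.+2)
      T i l *+ (fiber_size j i * fiber_size (m - j) l))%R; last first.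
    rewrite exchange_big; apply: eq_bigr => i _.
    rewrite exchange_big; apply: eq_bigr => l _.
    by rewrite -sum_fiber_sizeM -sumrMnr.
  apply: eq_bigr => j _; have jm := ltn_ord j.
  have -> : (m.+3 - (1 + j) = (m - j).+2)%N by lia.
  transitivity (\sum_(a <- Omega j.+2) \sum_(l < (m - j).+1)
     (\sum_(u <- Omega l.+1) F (Node (prune a) u)) *+ fiber_size (m - j) l)%R.
    apply: eq_big_Omega2 => a1 a2.
    rewrite -(IH (m - j)) ?ltnS; last by lia.
    exact: eq_big_Omega2.
  have widen k (c : nat -> V) : k <= m ->
      (\sum_(i < k.+1) c i *+ fiber_size k i =
       \sum_(i < m.+2) c i *+ fiber_size k i)%R.
    move=> km; rewrite (big_ord_widen m.+2 (fun i => c i *+ fiber_size k i)%R)//.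
      rewrite big_mkcond; apply: eq_bigr => i _; case: ltnP => // ki.
      by rewrite fiber_size_small ?mulr0n//; lia.
    by lia.
  rewrite exchange_big [RHS]exchange_big /=.
  transitivity (\sum_(l < (m - j).+1)
     (\sum_(i < m.+2) T i l *+ fiber_size j i) *+ fiber_size (m - j) l)%R.
    apply: eq_bigr => l _; rewrite -(widen _ (fun i => T i l)); last by lia.
    rewrite sumrMnl; congr (_ *+ _)%R.
    by rewrite (IH j _ (fun s => \sum_(u <- Omega l.+1) F (Node s u))%R)//; lia.
  rewrite (widen _ (fun l => \sum_(i < m.+2) T i l *+ fiber_size j i)%R);
    last by lia.
  apply: eq_bigr => l _; rewrite -sumrMnl; apply: eq_bigr => i _.
  by rewrite mulrnA.
rewrite [RHS]big_ord_recl fiber_size_rec0.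
under [X in _ = (_ + X)%R]eq_bigr do rewrite lift0 fiber_size_recS mulrnDr.
rewrite big_split /= addrA addrC; congr (_ + _)%R.
  rewrite -sumrMnl big_ord_recl [X in _ = (_ + X)%R]big_ord_recr /=.
  rewrite (@fiber_size_small m.+1 m.+2); last by lia.
  rewrite muln0 mulr0n addr0 mulnC mulrnA; congr (_ + _)%R.
  by apply: eq_bigr => i _; rewrite mulnC mulrnA.
(* Grouping by [p = i + j] rebuilds the trees with [p.+2] leaves; for [i + j > m.+1] the coefficient
   [fiber_conv] vanishes. *)
transitivity (\sum_(p < m.+2) \sum_(i < m.+2) \sum_(j < m.+2 | (i + j == p)%N)
   T i j *+ fiber_conv m p)%R; last first.
  apply: eq_bigr => p _; rewrite big_OmegaS.
  rewrite [X in (X *+ _)%R](_ : _ = \sum_(i < p.+1) T i (p - i)%N)%R; last first.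
    apply: eq_bigr => i _; rewrite /T subSn// -ltnS//.
  rewrite (big_antidiag T (ltn_ord p)) -sumrMnl; apply: eq_bigr => i _.
  by rewrite -sumrMnl.
rewrite [RHS]exchange_big /=; apply: eq_bigr => i _.
under [RHS]eq_bigr do rewrite big_mkcond.
rewrite [RHS]exchange_big /=; apply: eq_bigr => j _; rewrite -big_mkcond /=.
have [ij|ij] := ltnP (i + j) m.+2.
  apply/esym/(big_pred1 (Ordinal ij)) => p.
  by apply/eqP/eqP => [ijp|->//]; exact: val_inj.
rewrite /fiber_conv bin_small ?mul0n ?mulr0n; last by lia.
by rewrite big_pred0// => p; apply/eqP => ijp; have := ltn_ord p; lia.
Qed.

(** * Catalan numbers and the weights of the pruned size *)

Definition ntrees (n : nat) := size (Omega n).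

Lemma sum_Omega_const (V : nmodType) n (x : V) :
  (\sum_(t <- Omega n) x = x *+ ntrees n)%R.
Proof. by rewrite big_const_seq count_predT -Monoid.iteropE. Qed.

Lemma ntreesS n :
  ntrees n.+2 = \sum_(k < n.+1) ntrees k.+1 * ntrees (n.+1 - k).
Proof.
have := @big_OmegaS nat n (fun=> 1%R).
rewrite sum_Omega_const => E; rewrite -[LHS]natn; apply: (etrans E).
apply: eq_bigr => k _; rewrite !sum_Omega_const -mulrnA mulnC.
exact: natn.
Qed.

(** Exchanging the two subtrees symmetrises the weight: [k.+1] and [n.+1 - k] add up to [n.+2]. *)
Lemma sum_ntreesM n : 2 * \sum_(k < n.+1) k.+1 * (ntrees k.+1 * ntrees (n.+1 - k))
  = n.+2 * ntrees n.+2.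
Proof.
rewrite mul2n -addnn {2}(reindex_inj rev_ord_inj) /= -big_split /= ntreesS.
rewrite big_distrr; apply: eq_bigr => k _ /=; have kn := ltn_ord k.
rewrite (_ : n.+1 - (n.+1 - k.+1) = k.+1)%N; last by lia.
rewrite (_ : (n.+1 - k.+1).+1 = n.+1 - k)%N; last by lia.
by rewrite [X in (_ + _ * X)%N]mulnC -mulnDl; congr muln; lia.
Qed.

(** The Catalan ratio, from the convolution alone: the induction hypothesis applied to each factor
    of the weighted sum in [sum_ntreesM] turns it into the plain and weighted convolutions one size
    lower, both known. *)
Lemma ntrees_rec n : n.+2 * ntrees n.+2 = (4 * n + 2) * ntrees n.+1.
Proof.
elim/ltn_ind: n => -[//|n] IH.
rewrite -sum_ntreesM big_ord_recl.
under eq_bigr => k _.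
  rewrite lift0 subSS mulnA IH//.
  rewrite (_ : 4 * k + 2 = 4 * k.+1 - 2)%N; last by lia.
  rewrite mulnBl mulnBl -!mulnA.
  over.
have E := sum_ntreesM n; have E' := ntreesS n.
rewrite /= subn0 -[ntrees 1]/1 mul1n.
have : \sum_(k < n.+1) (4 * (k.+1 * (ntrees k.+1 * ntrees (n.+1 - k))) -
      2 * (ntrees k.+1 * ntrees (n.+1 - k))) + 2 * ntrees n.+2 =
    2 * (n.+2 * ntrees n.+2).
  rewrite E' big_distrr -big_split /= -E' -E mulnA big_distrr; apply: eq_bigr => k _ /=.
  by set c := ntrees _ * _; nia.
by set S := \sum_(_ < _) _; nia.
Qed.

Lemma ntrees_gt0 n : 0 < n -> 0 < ntrees n.
Proof.
case: n => // n _; elim: n => // n IH; have := ntrees_rec n; nia.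
Qed.

(** [fiber_size n i * ntrees i.+1] is the unnormalised probability that a tree with [n.+2] leaves
    prunes to [i.+1] leaves. The factor [4 i + 2] from [ntrees_rec] combines with [i + 1] into
    [(2 i + 1) (2 i + 2)], which the binomial coefficient absorbs. *)
Lemma fiber_weight_rec n i :
  4 * (i.+2 * i.+1) * (fiber_size n i.+1 * ntrees i.+2) =
  (n - i.*2) * (n - i.*2).-1 * (fiber_size n i * ntrees i.+1).
Proof.
rewrite /fiber_size doubleS.
have [ni|ni] := ltnP n i.*2.+2.
  rewrite (@bin_small n i.*2.+2)// !mul0n muln0.
  by have [->|->] : n - i.*2 = 0 \/ n - i.*2 = 1; [lia|..]; rewrite ?muln0 ?mul0n.
have E1 := mul_bin_left n i.*2; have E2 := mul_bin_left n i.*2.+1.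
have E3 := ntrees_rec i.
have E4 : 2 ^ (n - i.*2) = 4 * 2 ^ (n - i.*2.+2).
  by rewrite (_ : n - i.*2 = (n - i.*2.+2).+2) ?expnS; lia.
rewrite E4; rewrite subnS in E2.
transitivity (4 * i.+1 * 'C(n, i.*2.+2) * 2 ^ (n - i.*2.+2) * (i.+2 * ntrees i.+2)).
  by ring.
rewrite E3.
transitivity (4 * 2 ^ (n - i.*2.+2) * ntrees i.+1 *
   (i.*2.+1 * (i.*2.+2 * 'C(n, i.*2.+2)))).
  by rewrite -muln2; ring.
rewrite E2 (mulnCA i.*2.+1) E1; ring.
Qed.

Local Open Scope classical_set_scope.
Local Open Scope ring_scope.

(** * Uniform expectations and conditioning on the size of the pruned tree *)

Section mean.
Variable R : realFieldType.
Implicit Types (F G : btree -> R) (n : nat).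

Definition mean n F : R := (\sum_(t <- Omega n) F t) / (ntrees n)%:R.

Lemma eq_mean n F G : (forall t, leaves t = n -> F t = G t) ->
  mean n F = mean n G.
Proof.
move=> FG; rewrite /mean; congr (_ / _).
have E (H : btree -> R) : \sum_(t <- Omega n) H t =
    \sum_(t <- Omega n) (if leaves t == n then H t else 0).
  rewrite (big_Omega_leaves n (fun l t => if l == n then H t else 0)).
  by apply: eq_bigr => t _; rewrite eqxx.
by rewrite E [RHS]E; apply: eq_bigr => t _; case: eqP => // /FG.
Qed.

Lemma ler_mean n F G : (forall t, leaves t = n -> F t <= G t) ->
  mean n F <= mean n G.
Proof.
(* The inequality is known only on trees with [n] leaves; the maximum makes it hold for every
   tree. *)
move=> FG; rewrite (@eq_mean n G (fun t => Num.max (F t) (G t))).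
  rewrite ler_wpM2r ?invr_ge0// ler_sum// => t _.
  by rewrite le_max lexx.
by move=> t /FG /max_idPr.
Qed.

Lemma mean_cst n (c : R) : (0 < n)%N -> mean n (fun=> c) = c.
Proof.
move=> n0; rewrite /mean sum_Omega_const -[c *+ _]mulr_natr mulfK//.
by rewrite pnatr_eq0 -lt0n ntrees_gt0.
Qed.

Lemma meanD n F G : mean n (fun t => F t + G t) = mean n F + mean n G.
Proof. by rewrite /mean big_split mulrDl. Qed.

Lemma meanN n F : mean n (fun t => - F t) = - mean n F.
Proof. by rewrite /mean sumrN mulNr. Qed.

Lemma meanB n F G : mean n (fun t => F t - G t) = mean n F - mean n G.
Proof. by rewrite meanD meanN. Qed.

Lemma meanZ n (c : R) F : mean n (fun t => c * F t) = c * mean n F.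
Proof. by rewrite /mean -mulr_sumr mulrA. Qed.

Lemma ler_norm_mean n F : `|mean n F| <= mean n (fun t => `|F t|).
Proof.
rewrite /mean normrM [`|_^-1|]ger0_norm ?invr_ge0//.
by rewrite ler_wpM2r ?invr_ge0// ler_norm_sum.
Qed.

Lemma mean_le n F (c : R) : (0 < n)%N ->
  (forall t, leaves t = n -> F t <= c) -> mean n F <= c.
Proof. by move=> n0 Fc; rewrite -(mean_cst c n0) ler_mean. Qed.

(** Fibers over trees of equal size have equal cardinality, so [prune t] is uniform given its number
    of leaves. *)
Lemma mean_tower n G : (1 < n)%N ->
  mean n (fun t => G (prune t)) = mean n (fun t => mean (leaves (prune t)) G).
Proof.
case: n => [|[|n]]// _; rewrite /mean; congr (_ / _).
rewrite !big_Omega_prune (big_Omega_prune _ (fun s => mean (leaves s) G)).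
apply: eq_bigr => i _.
rewrite (big_Omega_leaves _ (fun l _ => mean l G)) sum_Omega_const.
rewrite /mean -[_ *+ ntrees _]mulr_natr divfK//.
by rewrite pnatr_eq0 -lt0n ntrees_gt0.
Qed.

(** Each leaf of the pruned tree stems from its own cherry, hence from two leaves of [t]. *)
Lemma leaves_prune t : (1 < leaves t)%N -> ((leaves (prune t)).*2 <= leaves t)%N.
Proof.
elim: t => // a IHa b IHb _; rewrite pruneE /= !is_leafE.
have a0 := leaves_gt0 a; have b0 := leaves_gt0 b.
case: eqP => a1.
  have [b1|b1] := ltnP 1%N (leaves b); first by have := IHb b1; lia.
  have : is_leaf b by rewrite is_leafE; lia.
  by case: b b0 {IHb b1} => //=; lia.
have {}IHa := IHa ltac:(lia).
case: eqP => b1; first lia.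
have {}IHb := IHb ltac:(lia).
by rewrite /=; lia.
Qed.

(* The weights [p_m] of the law of [M = leaves (prune t)] satisfy
   4 m (m+1) p_(m+1) = (n-2m) (n-2m-1) p_m; summation by parts against [g]
   yields an exact Stein-type identity. *)
Lemma mean_stein n (g : nat -> R) :
  mean n.+2 (fun t => let m := leaves (prune t) in
    4 * m%:R * (m%:R - 1) * g m.-1) =
  mean n.+2 (fun t => let m := leaves (prune t) in
    (n.+2%:R - 2 * m%:R) * (n.+2%:R - 2 * m%:R - 1) * g m).
Proof.
rewrite /mean /=; congr (_ / _).
have law (f : nat -> R) : \sum_(t <- Omega n.+2) f (leaves (prune t)) =
    \sum_(i < n.+1) f i.+1 * (fiber_size n i * ntrees i.+1)%:R.
  rewrite (big_Omega_prune _ (fun s => f (leaves s))); apply: eq_bigr => i _.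
  rewrite (big_Omega_leaves _ (fun l _ => f l)) sum_Omega_const -mulrnA.
  by rewrite mulr_natr mulnC.
rewrite (law (fun m => 4 * m%:R * (m%:R - 1) * g m.-1)).
rewrite (law (fun m => (n.+2%:R - 2 * m%:R) * (n.+2%:R - 2 * m%:R - 1) * g m)).
(* Boundary terms vanish: [m - 1 = 0] at the first index; at the last one the weight is 0, or
   [n.+2 - 2 m = 0] when [n = 0]. *)
rewrite big_ord_recl big_ord_recr /= subrr mulr0 !mul0r add0r.
rewrite [X in _ = _ + X](_ : _ = 0) ?addr0; last first.
  case: n {law} => [|n]; first by rewrite (_ : 2%:R - 2 * 1%:R = 0)// ?mul0r//; ring.
  by rewrite fiber_size_small ?mul0n ?mulr0//; lia.
apply: eq_bigr => i _; rewrite /bump leq0n add1n /=.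
transitivity (g i.+1 * (4 * (i.+2 * i.+1) * (fiber_size n i.+1 * ntrees i.+2))%:R).
  by rewrite !natrM -[in X in _ * (X - 1)]natr1; ring.
rewrite fiber_weight_rec natrM [in LHS]natrM.
have [ni|ni] := ltnP n i.*2; first by rewrite fiber_size_small// mul0n !mulr0.
have E1 : (n - i.*2)%:R = n.+2%:R - 2 * i.+1%:R :> R.
  by rewrite natrB// -muln2 -addn2 -[i.+1]addn1 !natrD natrM; ring.
rewrite -E1; case: (n - i.*2)%N => [|k]; first by rewrite !mul0r mulr0.
by rewrite natrM /= -[k.+1]addn1 natrD; ring.
Qed.
End mean.

(** * Gaussian expectations and Stein's equation *)

Section gauss.
Variable R : realType.
Implicit Types (h f : R -> R) (m s w x y z a b : R).
Notation mu := (@lebesgue_measure R).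

Definition lipschitz1 h := forall x y, `|h x - h y| <= `|x - y|.

Definition BL h := (forall x, `|h x| <= 1) /\ lipschitz1 h.

Lemma BL_bound h x : BL h -> `|h x| <= 1. Proof. by case. Qed.

Lemma lipschitz1_continuous h : lipschitz1 h -> continuous h.
Proof.
move=> hl x; apply/cvgrPdist_le => e e0.
by exists e => // y /= xy; exact: le_trans (hl _ _) (ltW xy).
Qed.

Lemma BL_continuous h : BL h -> continuous h.
Proof. by case=> _; exact: lipschitz1_continuous. Qed.

Definition nmean m s h : R := \int[mu]_x (h x * normal_pdf m s x).

Definition gauss h : R := nmean 0 1 h.

Lemma integrable_nmean m s B h : continuous h -> (forall x, `|h x| <= B) ->
  mu.-integrable setT (EFin \o (fun x => h x * normal_pdf m s x)).
Proof.
move=> ch hB.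
apply: le_integrable (integrableZl measurableT B (integrable_normal_pdf m s)) => //.
- apply/measurable_EFinP; apply: measurable_funM.
    exact: continuous_measurable_fun.
  exact: measurable_normal_pdf.
- move=> x _ /=; rewrite lee_fin !normrM.
  by rewrite ler_wpM2r// (le_trans (hB x))// ler_norm.
Qed.

Lemma nmean_cst m s c : nmean m s (fun=> c) = c.
Proof.
rewrite /nmean RintegralZl//; last exact: integrable_normal_pdf.
by rewrite /Rintegral integral_normal_pdf mulr1.
Qed.

Lemma ler_nmean m s h1 h2 B : continuous h1 -> continuous h2 ->
  (forall x, `|h1 x| <= B) -> (forall x, `|h2 x| <= B) ->
  (forall x, h1 x <= h2 x) -> nmean m s h1 <= nmean m s h2.
Proof.
move=> c1 c2 b1 b2 h12; apply: le_Rintegral => //.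
- exact: integrable_nmean b1.
- exact: integrable_nmean b2.
- by move=> x _; rewrite ler_wpM2r// normal_pdf_ge0.
Qed.

Lemma nmean_bound m s h B : continuous h -> (forall x, `|h x| <= B) ->
  `|nmean m s h| <= B.
Proof.
move=> ch hB; have B0 : 0 <= B by rewrite (le_trans _ (hB 0)).
have cc (c : R) : continuous (fun _ : R => c) by move=> x; exact: cvg_cst.
rewrite ler_norml; apply/andP; split.
  rewrite -{1}(nmean_cst m s (- B)); apply: (@ler_nmean _ _ _ _ B) => // x.
    by rewrite normrN ger0_norm.
  by have := hB x; rewrite ler_norml => /andP[].
rewrite -(nmean_cst m s B); apply: (@ler_nmean _ _ _ _ B) => // x.
  by rewrite ger0_norm.
by have := hB x; rewrite ler_norml => /andP[].
Qed.

Lemma nmeanB m s h1 h2 B : continuous h1 -> continuous h2 ->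
  (forall x, `|h1 x| <= B) -> (forall x, `|h2 x| <= B) ->
  nmean m s (fun x => h1 x - h2 x) = nmean m s h1 - nmean m s h2.
Proof.
move=> c1 c2 b1 b2; rewrite -RintegralB//.
- by apply: eq_Rintegral => x _; rewrite mulrBl.
- exact: integrable_nmean b1.
- exact: integrable_nmean b2.
Qed.

Lemma nmeanZ m s k h B : continuous h -> (forall x, `|h x| <= B) ->
  nmean m s (fun x => k * h x) = k * nmean m s h.
Proof.
move=> c1 b1; rewrite -RintegralZl//; last exact: integrable_nmean b1.
by apply: eq_Rintegral => x _; rewrite mulrA.
Qed.

Lemma affine_continuous m s : continuous (fun x => m + s * x).
Proof.
move=> x; apply: cvgD; first exact: cvg_cst.
by apply: cvgM; [exact: cvg_cst|exact: cvg_id].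
Qed.

Lemma comp_affine_continuous h m s : continuous h ->
  continuous (fun x => h (m + s * x)).
Proof.
move=> ch x; apply: (@continuous_comp _ _ _ (fun x => m + s * x) h).
  exact: affine_continuous.
exact: ch.
Qed.

Lemma normal_pdf_affine m s x : 0 < s ->
  normal_pdf m s (m + s * x) * s = normal_pdf 0 1 x.
Proof.
move=> s0; rewrite !normal_pdfE ?oner_eq0 ?gt_eqF// /normal_peak /normal_fun.
rewrite expr1n mul1r -mulrnAr sqrtrM ?sqr_ge0// sqrtr_sqr gtr0_norm// invfM.
rewrite -[s^-1 * _ * _]mulrA mulrAC mulVf ?gt_eqF// mul1r.
rewrite (_ : - (m + s * x - m) ^+ 2 / (s ^+ 2 *+ 2) = - (x - 0) ^+ 2 / 2)//.
by rewrite -(mulr_natr _ 2); field; rewrite gt_eqF.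
Qed.

Lemma nmean_affine m s h B : 0 < s -> continuous h -> (forall x, `|h x| <= B) ->
  nmean m s h = gauss (fun x => h (m + s * x)).
Proof.
(* Adding [B] makes the function non-negative, as the substitution theorem requires. *)
move=> s0 ch hb; pose h1 x := h x - (- B).
have cc (c : R) : continuous (fun _ : R => c) by move=> x; exact: cvg_cst.
have c1 : continuous h1.
  by move=> x; apply: cvgB; [exact: ch|exact: cc].
have h10 x : 0 <= h1 x.
  by rewrite /h1 subr_ge0; have := hb x; rewrite ler_norml => /andP[].
suff E : nmean m s h1 = gauss (fun x => h1 (m + s * x)).
  have b1 (x : R) : `|- B| <= B.
    by rewrite normrN ger0_norm// (le_trans _ (hb x)).
  move: E; rewrite /gauss (@nmeanB m s h _ B)//.
  rewrite (@nmeanB 0 1 (fun x => h (m + s * x)) _ B)//; last first.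
    exact: comp_affine_continuous.
  by rewrite !nmean_cst => /addIr.
rewrite /gauss /nmean /Rintegral; congr fine.
pose F x := m + s * x.
have dF x : is_derive x (1 : R) F s.
  rewrite /F; have : is_derive x (1 : R) (fun x => m + s * x) (0 + s *: 1).
    by apply: is_deriveD.
  by rewrite add0r scaler1.
have F'E : derive1 F = cst s.
  by apply/funext => x; rewrite derive1E; apply: derive_val.
rewrite (@increasing_ge0_integration_by_substitutionT _ F).
- apply: eq_integral => x _; congr EFin.
  by rewrite F'E -(normal_pdf_affine m x s0) mulrA.
- by move=> x y xy; rewrite /F ltrD2l ltr_pM2l.
- by rewrite F'E => x; exact: cvg_cst.
- by rewrite F'E; exact: is_cvg_cst.
- by rewrite F'E; exact: is_cvg_cst.
- by move=> x; apply: ex_derive.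
- apply/cvgrNyPle => A.
  apply: filterS (nbhs_ninfty_le (num_real ((A - m) / s))) => x.
  by rewrite ler_pdivlMr// mulrC lerBrDl.
- apply/cvgryPge => A.
  apply: filterS (nbhs_pinfty_ge (num_real ((A - m) / s))) => x.
  by rewrite ler_pdivrMr// mulrC lerBlDl.
- move=> x; apply: cvgM; first exact: c1.
  by apply: continuous_normal_pdf; rewrite gt_eqF.
- by move=> x; rewrite mulr_ge0// normal_pdf_ge0.
Qed.
End gauss.

(** * The standard normal density and its tails *)

Section stein_equation.
Variable R : realType.
Implicit Types (h f : R -> R) (m s w x y z a b : R).
Notation mu := (@lebesgue_measure R).
Notation phi := (@normal_pdf R 0 1).

Lemma is_derive_continuous f (df : R -> R) :
  (forall x, is_derive x 1 f (df x)) -> continuous f.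
Proof.
move=> fdf x; apply: differentiable_continuous.
by apply/derivable1_diffP; have [] := fdf x.
Qed.

Lemma is_derive_MVT f (df : R -> R) a b : a <= b ->
  (forall x, is_derive x 1 f (df x)) ->
  exists2 c, a <= c <= b & f b - f a = df c * (b - a).
Proof.
move=> ab fdf; have cf := is_derive_continuous fdf.
have [c] := MVT_segment ab (fun x _ => fdf x) (continuous_subspaceT cf).
by rewrite in_itv /= => ? ?; exists c.
Qed.

Lemma is_derive_expR_sqr (k x : R) :
  is_derive x 1 (fun y => expR (k * y ^+ 2)) (2 * k * x * expR (k * x ^+ 2)).
Proof.
have dg : is_derive x 1 (fun y : R => k * y ^+ 2) (k * (2 * x)).
  have d2 : is_derive x 1 (fun y : R => y ^+ 2) (2 * x).
    apply: is_derive_eq (is_deriveX 2 (is_derive_id x 1)) _.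
    by rewrite expr1 /GRing.scale /= mulr1.
  exact: is_derive_eq (is_deriveZ k d2) _.
apply: is_derive_eq (is_derive1_comp (is_derive_expR _) dg) _.
by ring.
Qed.

Lemma stdnormal_pdfE x : phi x = normal_peak 1 * expR (- (1 / 2) * x ^+ 2).
Proof.
rewrite normal_pdfE ?oner_eq0// /normal_fun; congr (_ * expR _).
by rewrite subr0 expr1n; field.
Qed.

Lemma stdnormal_pdfN x : phi (- x) = phi x.
Proof. by rewrite !stdnormal_pdfE sqrrN. Qed.

Lemma is_derive_stdnormal_pdf x : is_derive x 1 phi (- (x * phi x)).
Proof.
have -> : phi = fun y => normal_peak 1 * expR (- (1 / 2) * y ^+ 2).
  by apply/funext => y; rewrite stdnormal_pdfE.
apply: is_derive_eq (is_deriveZ (normal_peak 1) (is_derive_expR_sqr _ x)) _.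
by rewrite /GRing.scale /=; field.
Qed.

Lemma stdnormal_pdf_gt0 x : 0 < phi x.
Proof. by rewrite stdnormal_pdfE mulr_gt0 ?expR_gt0// normal_peak_gt0 ?oner_eq0. Qed.

Lemma continuous_phi : continuous phi.
Proof. by apply: continuous_normal_pdf; rewrite oner_eq0. Qed.

Lemma integrable_phi (D : set R) : measurable D ->
  mu.-integrable D (EFin \o phi).
Proof.
move=> mD; apply: (integrableS measurableT) => //.
exact: integrable_normal_pdf.
Qed.

Definition upper_tail w : R := \int[mu]_(x in `[w, +oo[) phi x.

Lemma upper_tail_le1 w : upper_tail w <= 1.
Proof.
rewrite -lee_fin /upper_tail /Rintegral fineK; last first.
  by apply: integrable_fin_num => //; exact: integrable_phi.
rewrite -(integral_normal_pdf (0 : R) 1); apply: ge0_subset_integral => //.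
  by apply/measurable_EFinP; exact: measurable_normal_pdf.
by move=> x _; rewrite lee_fin normal_pdf_ge0.
Qed.

Lemma lower_tailE w : \int[mu]_(x in `]-oo, w]) phi x = upper_tail (- w).
Proof.
rewrite /upper_tail /Rintegral; congr fine.
rewrite -{1}[w]opprK ge0_integration_by_substitutionNy.
- by apply: eq_integral => x _ /=; rewrite stdnormal_pdfN.
- by apply: continuous_subspaceT; exact: continuous_phi.
- by move=> x _; exact: normal_pdf_ge0.
Qed.

Lemma cvg_phi_pinfty : - phi x @[x --> +oo] --> (0 : R).
Proof.
apply/cvgrPdist_le => e e0.
(* The threshold comes from [1 + y <= expR y], which gives [phi x <= 2 * normal_peak 1 / x] for
   [x >= 1]. *)
apply: filterS (nbhs_pinfty_ge (num_real (Num.max 1 (2 * normal_peak 1 / e)))) => x.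
rewrite ge_max => /andP[x1 xe].
rewrite sub0r opprK gtr0_norm ?stdnormal_pdf_gt0//.
rewrite stdnormal_pdfE mulNr expRN.
have p0 : 0 < normal_peak (1 : R) by rewrite normal_peak_gt0// oner_eq0.
have E := expR_ge1Dx (1 / 2 * x ^+ 2).
have E0 : 0 < expR (1 / 2 * x ^+ 2) by exact: expR_gt0.
rewrite ler_pdivrMr//.
have : 2 * normal_peak 1 <= x * e by rewrite -ler_pdivrMr.
by nra.
Qed.

(** On the tail [w <= x], and [x * phi x] integrates to [phi w] because [- phi] is a primitive. *)
Lemma mills w : 0 <= w -> w * upper_tail w <= phi w.
Proof.
move=> w0.
have c1 : continuous (fun x => x * phi x).
  by move=> x; apply: cvgM; [exact: cvg_id|exact: continuous_phi].
have d1 x : is_derive x 1 (fun x => - phi x) (x * phi x).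
  by apply: is_derive_eq (is_deriveN (is_derive_stdnormal_pdf x)) _; rewrite opprK.
have E : (\int[mu]_(x in `[w, +oo[) (x * phi x)%:E = 0%:E - (- phi w)%:E)%E.
  apply: (@ge0_continuous_FTC2y R _ (fun x => - phi x) w 0).
  - by move=> x wx; rewrite mulr_ge0 ?normal_pdf_ge0// (le_trans w0).
  - exact: continuous_subspaceT.
  - exact: cvg_phi_pinfty.
  - by move=> x _; have [] := d1 x.
  - apply: (@cvg_at_right_filter R _ (fun x => - phi x)).
    exact: (is_derive_continuous d1).
  - by move=> x _; rewrite derive1E; have [] := d1 x.
rewrite -lee_fin; rewrite -EFinB sub0r opprK in E; rewrite -E EFinM /upper_tail.
rewrite /Rintegral fineK; last first.
  by apply: integrable_fin_num => //; exact: integrable_phi.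
rewrite -ge0_integralZl//.
- apply: ge0_le_integral => //.
  + by move=> x _; rewrite mule_ge0// lee_fin normal_pdf_ge0.
  + apply: measurable_funeM; apply/measurable_EFinP.
    by apply: measurable_funTS; exact: measurable_normal_pdf.
  + apply/measurable_EFinP; apply: measurable_funTS.
    exact: continuous_measurable_fun.
  + move=> x; rewrite /= in_itv/= andbT => wx.
    by rewrite -EFinM lee_fin ler_wpM2r// normal_pdf_ge0.
- by apply/measurable_EFinP/measurable_funTS; exact: measurable_normal_pdf.
- by move=> x _; rewrite lee_fin normal_pdf_ge0.
Qed.
End stein_equation.

(** * The solution of Stein's equation and its bounds *)

Section stein_solution.
Variable R : realType.
Implicit Types (h f : R -> R) (m s w x y z a b : R).
Notation mu := (@lebesgue_measure R).
Notation phi := (@normal_pdf R 0 1).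

(** One constant for the solution and its derivative: [2 / phi 1] controls the solution on
    [|w| <= 1], and [4 = 2 + 2] bounds the two parts of [stein_der]. *)
Definition stein_bound : R := 4 + 2 / phi 1.

Definition stein_primitive h w : R :=
  \int[mu]_(t in `]-oo, w]) ((h t - gauss h) * phi t).

Lemma gauss_bound h : BL h -> `|gauss h| <= 1.
Proof.
by move=> hBL; apply: nmean_bound => [|x]; [exact: BL_continuous|exact: BL_bound].
Qed.

Lemma BL_sub_gauss_le2 h x : BL h -> `|h x - gauss h| <= 2.
Proof.
move=> hBL; rewrite (le_trans (ler_normB _ _))// (_ : 2 = 1 + 1)//.
by rewrite lerD ?BL_bound ?gauss_bound.
Qed.

Lemma continuous_sub_gauss h : BL h -> continuous (fun x => h x - gauss h).
Proof.
move=> hBL x; apply: cvgB; [exact: BL_continuous|exact: cvg_cst].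
Qed.

Lemma integrable_sub_gauss h (D : set R) : measurable D -> BL h ->
  mu.-integrable D (EFin \o (fun t => (h t - gauss h) * phi t)).
Proof.
move=> mD hBL; apply: (integrableS measurableT) => //.
apply: (@integrable_nmean _ _ _ 2); first exact: continuous_sub_gauss.
by move=> x; exact: BL_sub_gauss_le2.
Qed.

Lemma integral_sub_gauss_le h (D : set R) : measurable D -> BL h ->
  `|\int[mu]_(t in D) ((h t - gauss h) * phi t)| <= 2 * \int[mu]_(t in D) phi t.
Proof.
move=> mD hBL; apply: le_trans (le_normr_Rintegral _ _) _ => //.
  exact: integrable_sub_gauss.
rewrite -RintegralZl//; last exact: integrable_phi.
apply: le_Rintegral => //.
- by apply: (@integrable_norm _ _ _ mu); exact: integrable_sub_gauss.
- apply: (integrableS measurableT) => //.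
  apply: (@integrable_nmean _ _ _ 2 (fun=> 2)) => [x|x]; first exact: cvg_cst.
  by rewrite ger0_norm.
- move=> x _; rewrite normrM [`|phi x|]ger0_norm ?normal_pdf_ge0//.
  by rewrite ler_wpM2r ?normal_pdf_ge0// BL_sub_gauss_le2.
Qed.

(* The integrand has total mass zero, so the integral may be taken over the
   tail on the same side as [w]. *)
Lemma stein_primitive_le h w : BL h ->
  `|stein_primitive h w| <= 2 * upper_tail `|w|.
Proof.
move=> hBL; have [w0|w0] := lerP 0 w; last first.
  by rewrite (ltr0_norm w0) -lower_tailE; exact: integral_sub_gauss_le.
have tot : \int[mu]_(t in `]-oo, +oo[) ((h t - gauss h) * phi t) = 0.
  rewrite set_itvNyy.
  have cc : continuous (fun _ : R => gauss h) by move=> x; exact: cvg_cst.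
  rewrite -/(nmean 0 1 (fun t => h t - gauss h)) (@nmeanB _ _ _ _ _ 1)//.
  - by rewrite nmean_cst subrr.
  - exact: BL_continuous.
  - by move=> x; exact: BL_bound.
  - by move=> x; exact: gauss_bound.
have := @Rintegral_itvB R (fun t => (h t - gauss h) * phi t) -oo%O +oo%O w.
rewrite tot sub0r => E.
rewrite (ger0_norm w0) -normrN /stein_primitive E//; last exact: integrable_sub_gauss.
rewrite /upper_tail -Rintegral_itv_obnd_cbnd; last exact: integrable_phi.
exact: integral_sub_gauss_le.
Qed.

Definition stein_sol h w : R := stein_primitive h w / phi w.

(** Stein's equation solved for the derivative, so that the equation holds by definition and only
    differentiability remains to be shown. *)
Definition stein_der h w : R := h w - gauss h + w * stein_sol h w.

Lemma is_derive_stein_sol h w : BL h -> is_derive w 1 (stein_sol h) (stein_der h w).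
Proof.
move=> hBL.
pose g t := (h t - gauss h) * phi t.
have dP : is_derive w 1 (stein_primitive h) (g w).
  have [||||H1 H2] := @continuous_FTC1 R g -oo%O w (w + 1).
  - by rewrite ltrDl.
  - exact: integrable_sub_gauss.
  - exact: ltNyr.
  - by apply: cvgM; [exact: continuous_sub_gauss|exact: continuous_phi].
  by split => //; rewrite -derive1E.
have p0 : normal_peak (1 : R) != 0 by rewrite gt_eqF// normal_peak_gt0// oner_eq0.
(* Writing [1 / phi] as an exponential replaces the quotient rule by the product rule. *)
pose psi x := (normal_peak 1)^-1 * expR (1 / 2 * x ^+ 2).
have psiE x : (phi x)^-1 = psi x.
  by rewrite stdnormal_pdfE invfM mulNr expRN [(expR _)^-1^-1]invrK.
have dpsi : is_derive w 1 psi (w * psi w).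
  apply: is_derive_eq (is_deriveZ (normal_peak 1)^-1 (is_derive_expR_sqr _ w)) _.
  by rewrite /GRing.scale /= /psi; field.
have -> : stein_sol h = stein_primitive h * psi.
  by apply/funext => x; rewrite /stein_sol psiE.
apply: is_derive_eq (is_deriveM dP dpsi) _.
rewrite /GRing.scale /= /stein_der /stein_sol psiE /g.
have : psi w * phi w = 1 by rewrite -psiE mulVf// gt_eqF// stdnormal_pdf_gt0.
by move=> E; ring: E.
Qed.

Lemma stein_sol_mul_le h w : BL h -> `|w * stein_sol h w| <= 2.
Proof.
move=> hBL; rewrite /stein_sol mulrA normrM normfV.
rewrite [`|phi w|]gtr0_norm ?stdnormal_pdf_gt0// ler_pdivrMr ?stdnormal_pdf_gt0//.
rewrite normrM.
have H := stein_primitive_le w hBL; have M := mills (normr_ge0 w).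
have E : phi `|w| = phi w by case: (ger0P w) => // _; rewrite stdnormal_pdfN.
rewrite E in M; have := normr_ge0 w; by nra.
Qed.

(** For [|w| <= 1] the density is at least [phi 1]; for [|w| > 1] the bound on [w * stein_sol h w]
    suffices. *)
Lemma stein_sol_le h w : BL h -> `|stein_sol h w| <= stein_bound.
Proof.
move=> hBL; have p1 := stdnormal_pdf_gt0 (1 : R); have pw := stdnormal_pdf_gt0 w.
have i1 : 0 < 2 / phi 1 by rewrite divr_gt0.
have [w1|w1] := lerP `|w| 1.
  rewrite /stein_sol normrM normfV [`|phi w|]gtr0_norm// ler_pdivrMr//.
  have H := stein_primitive_le w hBL; have M := upper_tail_le1 `|w|.
  have pp : phi 1 <= phi w.
    rewrite !stdnormal_pdfE ler_wpM2l ?normal_peak_ge0// ler_expR !mulNr lerN2.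
    by rewrite ler_wpM2l// -[w ^+ 2]real_normK ?num_real// lerXn2r ?nnegrE.
  have : 2 <= 2 / phi 1 * phi w by rewrite mulrAC ler_pdivlMr// ler_pM2l.
  by rewrite /stein_bound mulrDl; lra.
have := stein_sol_mul_le w hBL; rewrite normrM /stein_bound.
have := normr_ge0 (stein_sol h w); by nra.
Qed.

Lemma stein_der_le h w : BL h -> `|stein_der h w| <= stein_bound.
Proof.
move=> hBL; have i1 : 0 < 2 / phi 1 by rewrite divr_gt0// stdnormal_pdf_gt0.
rewrite (le_trans (ler_normD _ _))// /stein_bound.
have := BL_sub_gauss_le2 w hBL; have := stein_sol_mul_le w hBL; lra.
Qed.

Lemma stein_bound_ge0 : 0 <= stein_bound.
Proof.
by rewrite /stein_bound addr_ge0// divr_ge0// normal_pdf_ge0.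
Qed.

Lemma stein_sol_lipschitz h x y : BL h ->
  `|stein_sol h x - stein_sol h y| <= stein_bound * `|x - y|.
Proof.
wlog xy : x y / y <= x => [H hBL|hBL].
  case/orP: (le_total y x) => [/H|/H] Hxy; first exact: Hxy.
  by rewrite distrC [`|x - y|]distrC; exact: Hxy.
have [c _ ->] := is_derive_MVT xy (fun x => is_derive_stein_sol x hBL).
by rewrite normrM ler_wpM2r// stein_der_le.
Qed.

(** Since [h] is only Lipschitz, a second derivative is avoided by splitting the product in
    [stein_der]; the resulting linear growth in [|x|] is later absorbed by a second moment. *)
Lemma stein_der_lipschitz h x y : BL h ->
  `|stein_der h x - stein_der h y| <=
  (1 + stein_bound + stein_bound * `|x|) * `|x - y|.
Proof.
move=> hBL.
have -> : stein_der h x - stein_der h y = (h x - h y) +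
    (x * (stein_sol h x - stein_sol h y) + (x - y) * stein_sol h y).
  by rewrite /stein_der; ring.
have H1 : `|h x - h y| <= `|x - y| by case: hBL.
have H2 := stein_sol_lipschitz x y hBL.
have H3 := stein_sol_le y hBL.
have -> : (1 + stein_bound + stein_bound * `|x|) * `|x - y| =
    `|x - y| + (`|x| * (stein_bound * `|x - y|) + `|x - y| * stein_bound).
  by ring.
rewrite (le_trans (ler_normD _ _))// lerD//.
rewrite (le_trans (ler_normD _ _))// lerD// normrM ler_wpM2l//.
Qed.

Lemma stein_sol_taylor h (d : R) x : BL h -> 0 <= d ->
  `|stein_sol h x - stein_sol h (x - d) - d * stein_der h x| <=
  d ^+ 2 * (1 + stein_bound + stein_bound * `|x|).
Proof.
move=> hBL d0; have dx : x - d <= x by rewrite gerBl.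
have [c /andP[c1 c2] ->] := is_derive_MVT dx (fun x => is_derive_stein_sol x hBL).
have -> : stein_der h c * (x - (x - d)) - d * stein_der h x =
    d * (stein_der h c - stein_der h x) by ring.
rewrite normrM (ger0_norm d0).
rewrite expr2 -mulrA ler_wpM2l// mulrC distrC.
have K0 : 0 <= 1 + stein_bound + stein_bound * `|x|.
  by have := mulr_ge0 stein_bound_ge0 (normr_ge0 x); have := stein_bound_ge0; lra.
rewrite (le_trans (stein_der_lipschitz _ _ hBL))// ler_wpM2l// ger0_norm ?subr_ge0//.
by rewrite lerBlDr -lerBlDl.
Qed.
End stein_solution.

(** * Scaling and convolution of Gaussians *)

Section gauss_convolution.
Variable R : realType.
Implicit Types (h f : R -> R) (m s w x y z a b : R).
Notation mu := (@lebesgue_measure R).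
Notation phi := (@normal_pdf R 0 1).

Lemma integrable_norm_phi :
  mu.-integrable setT (EFin \o (fun x => `|x| * phi x)).
Proof.
have p1 := @normal_peak_gt0 R 1 (oner_neq0 _).
have p2 : 0 < normal_peak (2 : R) by rewrite normal_peak_gt0.
(* The majorant is the density of standard deviation 2: the exponents differ by [3 / 8 * x ^+ 2],
   whose exponential dominates [|x|]. *)
apply: le_integrable (integrableZl measurableT (normal_peak 1 / normal_peak 2)
   (integrable_normal_pdf 0 2)) => //.
  apply/measurable_EFinP; apply: measurable_funM; first exact: normr_measurable.
  exact: measurable_normal_pdf.
move=> x _ /=; rewrite lee_fin ger0_norm ?mulr_ge0 ?normal_pdf_ge0//.
rewrite [leRHS]ger0_norm ?mulr_ge0 ?normal_pdf_ge0 ?invr_ge0 ?normal_peak_ge0//.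
rewrite stdnormal_pdfE normal_pdfE ?gt_eqF// /normal_fun.
rewrite [leRHS](_ : _ = normal_peak 1 * expR (- (x - 0) ^+ 2 / (2 ^+ 2 *+ 2)));
  last by field; rewrite gt_eqF.
rewrite mulrCA ler_pM2l// (_ : - (x - 0) ^+ 2 / (2 ^+ 2 *+ 2) =
   3 / 8 * x ^+ 2 + (- (1 / 2) * x ^+ 2)); last by field.
rewrite expRD ler_pM2r ?expR_gt0//.
have := expR_ge1Dx (3 / 8 * x ^+ 2).
have : `|x| ^+ 2 = x ^+ 2 by rewrite real_normK// num_real.
by have := sqr_ge0 (`|x| - 4 / 3); nra.
Qed.

Definition gauss_abs : R := \int[mu]_x (`|x| * phi x).

Lemma gauss_scale_lipschitz h m a b : BL h ->
  `|gauss (fun x => h (m + a * x)) - gauss (fun x => h (m + b * x))| <=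
  `|a - b| * gauss_abs.
Proof.
move=> hBL; have ch := BL_continuous hBL; have hb x := BL_bound x hBL.
have c a' : continuous (fun x => h (m + a' * x)) by exact: comp_affine_continuous.
have cB : continuous (fun x => h (m + a * x) - h (m + b * x)).
  by move=> x; apply: cvgB; exact: c.
have bB x : `|h (m + a * x) - h (m + b * x)| <= 1 + 1.
  by rewrite (le_trans (ler_normB _ _))// lerD.
rewrite /gauss -(@nmeanB _ _ _ _ _ 1)//.
apply: le_trans (le_normr_Rintegral _ _) _ => //.
  exact: integrable_nmean bB.
rewrite /gauss_abs -RintegralZl//; last exact: integrable_norm_phi.
apply: le_Rintegral => //.
- by apply: (@integrable_norm _ _ _ mu); exact: integrable_nmean bB.
- exact: (integrableZl measurableT `|a - b| integrable_norm_phi).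
- move=> x _; rewrite normrM [`|phi x|]ger0_norm ?normal_pdf_ge0// mulrA.
  rewrite ler_wpM2r ?normal_pdf_ge0// -normrM.
  have -> : (a - b) * x = m + a * x - (m + b * x) by ring.
  by case: hBL.
Qed.

Lemma gauss_abs_ge0 : 0 <= gauss_abs.
Proof. by apply: Rintegral_ge0 => x _; rewrite mulr_ge0 ?normal_pdf_ge0. Qed.

Lemma BL_gauss h b : BL h -> BL (fun x => gauss (fun y => h (x + b * y))).
Proof.
move=> hBL; have ch := BL_continuous hBL; have hb x := BL_bound x hBL.
split=> [x|x y].
  by apply: nmean_bound => //; exact: comp_affine_continuous.
rewrite /gauss -(@nmeanB _ _ _ _ _ 1)//; try exact: comp_affine_continuous.
apply: nmean_bound => [z|z].
  by apply: cvgB; exact: comp_affine_continuous.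
rewrite (_ : x - y = x + b * z - (y + b * z)); last by ring.
by case: hBL.
Qed.

(** Detailed balance of the Ornstein-Uhlenbeck kernel: the joint density of a standard Gaussian pair
    with correlation [a] is symmetric. *)
Lemma normal_pdf_swap a b x z : 0 < b -> a ^+ 2 + b ^+ 2 = 1 ->
  normal_pdf (a * x) b z * phi x = normal_pdf (a * z) b x * phi z.
Proof.
move=> b0 ab; rewrite !stdnormal_pdfE !normal_pdfE ?gt_eqF// /normal_fun.
rewrite -!mulrA; congr (_ * _); rewrite mulrCA [in RHS]mulrCA; congr (_ * _).
rewrite -!expRD; congr expR; rewrite -(mulr_natr _ 2).
have ab' : a ^+ 2 = 1 - b ^+ 2 by rewrite -ab addrK.
by field: ab'; rewrite gt_eqF.
Qed.

(** Invariance of the standard Gaussian under this kernel: after the swap and Tonelli, the inner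
    integral is a total mass 1. *)
Lemma fubini_gauss a b h B : 0 < b -> a ^+ 2 + b ^+ 2 = 1 ->
  continuous h -> (forall x, 0 <= h x <= B) ->
  gauss (fun x => nmean (a * x) b h) = gauss h.
Proof.
move=> b0 ab ch hB.
have hb x : `|h x| <= B.
  by have /andP[h0 h1] := hB x; rewrite ger0_norm.
rewrite /gauss [LHS]/nmean [RHS]/nmean /Rintegral; congr fine.
pose f (p : R * R) : \bar R := (h p.2 * normal_pdf (a * p.1) b p.2 * phi p.1)%:E.
transitivity (\int[mu]_x \int[mu]_z f (x, z))%E.
  apply: eq_integral => x _; rewrite EFinM.
  rewrite /nmean /Rintegral fineK; last first.
    apply: integrable_fin_num => //; exact: integrable_nmean hb.
  rewrite -ge0_integralZr//.
  - by apply/measurable_EFinP; apply: measurable_funM;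
      [exact: continuous_measurable_fun|exact: measurable_normal_pdf].
  - by move=> z _; rewrite lee_fin mulr_ge0 ?normal_pdf_ge0//; have /andP[] := hB z.
  - by rewrite lee_fin normal_pdf_ge0.
rewrite fubini_tonelli.
- apply: eq_integral => z _ /=.
  transitivity (\int[mu]_x ((h z * phi z)%:E * (normal_pdf (a * z) b x)%:E))%E.
    apply: eq_integral => x _; rewrite /f /= -EFinM; congr EFin.
    by rewrite -mulrA normal_pdf_swap// mulrA mulrAC.
  rewrite integralZl//; last exact: integrable_normal_pdf.
  by rewrite integral_normal_pdf mule1.
- apply/measurable_EFinP; apply: measurable_funM; last first.
    by apply: (measurableT_comp (measurable_normal_pdf _ _)).
  apply: measurable_funM.
    by apply: measurableT_comp => //; exact: continuous_measurable_fun.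
  rewrite (_ : (fun p : R * R => _) = (fun p =>
     normal_pdf 0 b (p.2 - a * p.1))); last first.
    apply/funext => p; rewrite !normal_pdfE ?gt_eqF// /normal_fun.
    by rewrite subr0.
  apply: (measurableT_comp (measurable_normal_pdf _ _)).
  apply: measurable_funB => //; apply: measurable_funM => //.
- move=> [x z]; rewrite /f lee_fin !mulr_ge0 ?normal_pdf_ge0//=.
  by have /andP[] := hB z.
Qed.

Lemma gauss_conv h a b : BL h -> 0 <= a -> 0 <= b ->
  gauss (fun x => gauss (fun y => h (a * x + b * y))) =
  gauss (fun x => h (Num.sqrt (a ^+ 2 + b ^+ 2) * x)).
Proof.
move=> hBL; have ch := BL_continuous hBL; have hb x := BL_bound x hBL.
rewrite le_eqVlt => /predU1P[<- b0|a0].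
  rewrite expr0n add0r sqrtr_sqr ger0_norm// -[RHS](nmean_cst 0 1).
  by congr nmean; apply/funext => x; congr nmean; apply/funext => y; rewrite mul0r add0r.
rewrite le_eqVlt => /predU1P[<-|b0].
  rewrite expr0n addr0 sqrtr_sqr gtr0_norm//.
  congr nmean; apply/funext => x; rewrite -[RHS](nmean_cst 0 1).
  by congr nmean; apply/funext => y; rewrite mul0r addr0.
set c := Num.sqrt _.
have c0 : 0 < c by rewrite sqrtr_gt0 addr_gt0 ?exprn_gt0.
have cE : c ^+ 2 = a ^+ 2 + b ^+ 2 by rewrite sqr_sqrtr// addr_ge0 ?sqr_ge0.
(* Dividing by [c] puts the coefficients on the unit circle, where [fubini_gauss] applies; the shift
   by 1 makes [H] non-negative. *)
pose H z := h (c * z) - (-1).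
have cc (e : R) : continuous (fun _ : R => e) by move=> x; exact: cvg_cst.
have chc : continuous (fun z => h (c * z)).
  have := @comp_affine_continuous R h 0 c ch.
  by under [X in continuous X -> _]eq_fun do rewrite add0r.
have cH : continuous H by move=> x; apply: cvgB; [exact: chc|exact: cc].
have HB x : 0 <= H x <= 2.
  by rewrite /H; have := hb (c * x); rewrite ler_norml => /andP[] ? ?; apply/andP; lra.
have HB' x : `|H x| <= 2 by have /andP[? ?] := HB x; rewrite ger0_norm.
have b1 (x : R) : `|-1 : R| <= 1 by rewrite normrN1.
have F : gauss (fun x => nmean (a / c * x) (b / c) H) = gauss H.
  apply: (@fubini_gauss _ _ _ 2) => //; first by rewrite divr_gt0.
  by rewrite !expr_div_n -mulrDl -cE divff// expf_neq0// gt_eqF.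
have GH : gauss H = gauss (fun x => h (c * x)) - (-1).
  rewrite -[X in _ - X](nmean_cst 0 1 (-1)).
  by rewrite /gauss -(@nmeanB R 0 1 (fun x => h (c * x)) (fun=> -1) 1).
have E x : nmean (a / c * x) (b / c) H =
    gauss (fun y => h (a * x + b * y)) - (-1).
  rewrite (@nmean_affine _ _ _ _ 2) ?divr_gt0//.
  rewrite -[X in _ = _ - X](nmean_cst 0 1 (-1)) /gauss.
  rewrite -(@nmeanB R 0 1 (fun y => h (a * x + b * y)) (fun=> -1) 1)//.
    congr nmean; apply/funext => y; rewrite /H; congr (h _ - _).
    by field; rewrite gt_eqF.
  exact: comp_affine_continuous.
have GL : gauss (fun x => nmean (a / c * x) (b / c) H) =
    gauss (fun x => gauss (fun y => h (a * x + b * y))) - (-1).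
  have -> : (fun x => nmean (a / c * x) (b / c) H) =
      fun x => gauss (fun y => h (a * x + b * y)) - (-1) by exact/funext.
  rewrite -[X in _ = _ - X](nmean_cst 0 1 (-1)) [in LHS]/gauss.
  rewrite (@nmeanB R 0 1 (fun x => gauss (fun y => h (a * x + b * y)))
     (fun=> -1) 1)//.
  - have := BL_continuous (BL_gauss b hBL).
    move=> /(@comp_affine_continuous R _ 0 a).
    by under [X in continuous X -> _]eq_fun do rewrite add0r.
  - by move=> x; apply: nmean_bound => //; exact: comp_affine_continuous.
by move: F; rewrite GH GL => /addIr.
Qed.
End gauss_convolution.

(** * The central limit theorem along the pruning chain *)

Section one_step_clt.
Variable R : realType.
Implicit Types (h f : R -> R) (n : nat) (t : btree).

Definition std_leaves n m : R := (4 * m%:R - n%:R) / Num.sqrt n%:R.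

Definition std_pruned t : R := std_leaves (leaves t) (leaves (prune t)).

(** Lowering [m] by 1 moves the standardised value by [4 / sqrt n]. Near [m = n / 4] the difference
    term is about [n^(3/2) f'], so to leading order the identity compares [w f] with [f']. *)
Lemma mean_stein_std n f : (1 < n)%N ->
  mean n (fun t => let m := (leaves (prune t))%:R : R in
    n%:R * Num.sqrt n%:R * (std_pruned t * f (std_pruned t))
    - 4 * m * (m - 1) *
        (f (std_pruned t) - f (std_pruned t - 4 / Num.sqrt n%:R))
    - (6 * m - n%:R) * f (std_pruned t)) = 0.
Proof.
case: n => [|[|n]]// _; set s := Num.sqrt _.
have s0 : s != 0 by rewrite gt_eqF// sqrtr_gt0.
have ss : n.+2%:R = s ^+ 2 by rewrite sqr_sqrtr.
have := mean_stein n (fun m => f (std_leaves n.+2 m)).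
move=> /eqP; rewrite -subr_eq0 -meanB => /eqP E; rewrite -[RHS]E.
apply: eq_mean => t tn /=.
have m0 := leaves_gt0 (prune t); rewrite /std_pruned tn.
have -> : std_leaves n.+2 (leaves (prune t)).-1 =
    std_leaves n.+2 (leaves (prune t)) - 4 / s.
  rewrite /std_leaves -/s -[in RHS](prednK m0) -addn1 natrD.
  by field.
have : s * std_leaves n.+2 (leaves (prune t)) = 4 * (leaves (prune t))%:R - n.+2%:R.
  by rewrite /std_leaves -/s mulrC divfK.
set w := std_leaves _ _; set m := (leaves _)%:R => sw.
rewrite -[n.+2%:R * s * _]mulrA [s * _]mulrA sw.
by ring.
Qed.

(** The Stein identity for [f = id]: as [m <= n / 2] and [|w| <= s], the remaining terms are at most
    [4 s^3] and [2 s^3]. *)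
Lemma sqr_std_pruned_le n : (1 < n)%N -> mean n (fun t => std_pruned t ^+ 2) <= 6.
Proof.
move=> n1; have n0 : 0 < n%:R :> R by rewrite ltr0n; lia.
set s := Num.sqrt (n%:R : R).
have s0 : 0 < s by rewrite sqrtr_gt0.
have ss : n%:R = s ^+ 2 by rewrite sqr_sqrtr// ltW.
have := mean_stein_std id n1; rewrite -/s => E.
have s30 : 0 < s ^+ 3 by rewrite exprn_gt0.
rewrite -(ler_pM2l s30) -meanZ -subr_le0 -[X in _ <= X]E.
rewrite -[X in _ - X](@mean_cst R n); last by lia.
rewrite -meanB; apply: ler_mean => t tn /=.
have H := @leaves_prune t; rewrite tn in H; have {}H := H n1.
have m1 := leaves_gt0 (prune t).
have sw : s * std_pruned t = 4 * (leaves (prune t))%:R - n%:R.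
  by rewrite /std_pruned /std_leaves tn -/s mulrC divfK// gt_eqF.
have : 2 * (leaves (prune t))%:R <= n%:R :> R.
  by rewrite -natrM ler_nat; lia.
have : 1 <= (leaves (prune t))%:R :> R by rewrite ler1n.
move: sw; set w := std_pruned t; set m := (leaves _)%:R => sw mge mle.
have -> : w - (w - 4 / s) = 4 / s by ring.
have -> : n%:R * s * (w * w) = s ^+ 3 * w ^+ 2 by rewrite ss; ring.
have w1 : w <= s by rewrite -(ler_pM2l s0) sw -expr2 -ss; lra.
have w2 : - s <= w by rewrite -(ler_pM2l s0) sw mulrN -expr2 -ss; lra.
have A : 4 * m * (m - 1) * (4 / s) <= 4 * s ^+ 3.
  rewrite mulrA ler_pdivrMr// (_ : 4 * s ^+ 3 * s = 4 * n%:R ^+ 2).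
    by nra.
  by rewrite ss; ring.
have B : (6 * m - n%:R) * w <= 2 * s ^+ 3.
  rewrite ss in mle *.
  have -> : 2 * s ^+ 3 = 2 * s ^+ 2 * s by ring.
  nra.
by lra.
Qed.

(** Pointwise error in the Stein identity: [f] and [f'] stand for the solution and its derivative at
    [w], and [D] for the backward difference with step [4 / s]. *)
Lemma stein_error_le (m n s w f f' D C : R) : n = s ^+ 2 -> 1 <= s ->
  s * w = 4 * m - n -> 1 <= m -> 2 * m <= n -> `|f| <= C -> `|f'| <= C ->
  `|D - 4 / s * f'| <= (4 / s) ^+ 2 * (1 + C + C * `|w|) ->
  `|s ^+ 3 * f' - 4 * m * (m - 1) * D - (6 * m - n) * f| <=
  s ^+ 2 * (16 + 44 * C + 19 * C * w ^+ 2).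
Proof.
move=> ns s1 sw m1 mn fC f'C DC.
have s0 : 0 < s by lra.
have C0 : 0 <= C by rewrite (le_trans _ fC).
have ww : `|w| ^+ 2 = w ^+ 2 by rewrite real_normK// num_real.
have w0 := normr_ge0 w.
have wle : `|w| <= 1 + w ^+ 2 by rewrite -ww; nra.
have mE : m = (s * w + s ^+ 2) / 4 by rewrite sw ns; field.
have -> : s ^+ 3 * f' - 4 * m * (m - 1) * D - (6 * m - n) * f =
   (- (2 * s ^+ 2 * w) - s * w ^+ 2 + 16 * m / s) * f'
   + (- (4 * m * (m - 1)) * (D - 4 / s * f') + - (6 * m - n) * f).
  (* The leading coefficient [4 m^2 * (4 / s)] equals [s^3] plus terms of order [s^2 w] and [s w^2],
     which go into the error. *)
  have : (s ^+ 3 + (2 * s ^+ 2 * w) + s * w ^+ 2) = 16 * m ^+ 2 / s.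
    by rewrite mE; field; rewrite gt_eqF.
  move=> E.
  have -> : - (2 * s ^+ 2 * w) - s * w ^+ 2 = s ^+ 3 - 16 * m ^+ 2 / s by rewrite -E; ring.
  by field; rewrite gt_eqF.
rewrite (le_trans (ler_normD _ _))//.
have A : `|(- (2 * s ^+ 2 * w) - s * w ^+ 2 + 16 * m / s) * f'| <=
   s ^+ 2 * (2 * `|w| + w ^+ 2 + 8) * C.
  rewrite normrM ler_pM//.
  have -> : s ^+ 2 * (2 * `|w| + w ^+ 2 + 8) =
     2 * s ^+ 2 * `|w| + s ^+ 2 * w ^+ 2 + 8 * s ^+ 2 by ring.
  rewrite (le_trans (ler_normD _ _))// lerD//.
    rewrite (le_trans (ler_normB _ _))// lerD//.
      by rewrite normrN normrM ger0_norm// mulr_ge0// sqr_ge0.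
    rewrite ger0_norm; last by rewrite mulr_ge0 ?sqr_ge0// ltW.
    by rewrite ler_wpM2r ?sqr_ge0// expr2 ler_peMl// ltW.
  rewrite ger0_norm; last by rewrite divr_ge0// ?ltW//; lra.
  rewrite ler_pdivrMr// -ns; nra.
have B : `|- (4 * m * (m - 1)) * (D - 4 / s * f')| <=
   s ^+ 2 * (16 * (1 + C + C * `|w|)).
  rewrite normrM.
  have -> : s ^+ 2 * (16 * (1 + C + C * `|w|)) =
     s ^+ 4 * ((4 / s) ^+ 2 * (1 + C + C * `|w|)).
    by field; rewrite gt_eqF.
  rewrite ler_pM// normrN ger0_norm; last by rewrite mulr_ge0//; lra.
  by rewrite (_ : s ^+ 4 = n ^+ 2); [nra|rewrite ns; ring].
have E : `|- (6 * m - n) * f| <= s ^+ 2 * (2 * C).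
  rewrite normrM mulrA ler_pM// normrN ler_norml -ns; apply/andP; split; lra.
rewrite (le_trans (lerD A (ler_normD _ _)))//.
rewrite (le_trans (lerD (lexx _) (lerD B E)))//.
rewrite -mulrA -!mulrDr ler_pM2l ?exprn_gt0//.
have : C * `|w| <= C * (1 + w ^+ 2) by rewrite ler_wpM2l.
by nra.
Qed.

Lemma std_pruned_clt n h : (1 < n)%N -> BL h ->
  `|mean n (fun t => h (std_pruned t)) - gauss h| <=
  (16 + 158 * stein_bound R) / Num.sqrt n%:R.
Proof.
move=> n1 hBL; have n0 : 0 < n%:R :> R by rewrite ltr0n; lia.
set s := Num.sqrt (n%:R : R); set C := stein_bound R.
have C0 : 0 <= C := stein_bound_ge0 R.
have s0 : 0 < s by rewrite sqrtr_gt0.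
have ss : n%:R = s ^+ 2 by rewrite sqr_sqrtr// ltW.
have s1 : 1 <= s by rewrite -sqrtr1 ler_wsqrtr// ler1n; lia.
have s30 : 0 < s ^+ 3 by rewrite exprn_gt0.
rewrite ler_pdivlMr// -(ler_pM2l (exprn_gt0 2 s0)).
have -> : s ^+ 2 * (`|mean n (fun t => h (std_pruned t)) - gauss h| * s) =
    `|s ^+ 3 * (mean n (fun t => h (std_pruned t)) - gauss h)|.
  by rewrite normrM gtr0_norm//; ring.
rewrite -[X in _ - X](@mean_cst R n); last by lia.
rewrite -meanB -meanZ.
have Z := mean_stein_std (stein_sol h) n1.
rewrite -[X in `|X|]addr0 -[X in _ + X]Z -meanD.
rewrite (le_trans (ler_norm_mean _ _))//.
apply: (@le_trans _ _ (mean n (fun t => s ^+ 2 * (16 + 44 * C + 19 * C * std_pruned t ^+ 2)))).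
  apply: ler_mean => t tn /=.
  have H := @leaves_prune t; rewrite tn in H; have {}H := H n1.
  have m1 := leaves_gt0 (prune t).
  have sw : s * std_pruned t = 4 * (leaves (prune t))%:R - n%:R.
    by rewrite /std_pruned /std_leaves tn -/s mulrC divfK// gt_eqF.
  have mle : 2 * (leaves (prune t))%:R <= n%:R :> R.
    by rewrite -natrM ler_nat; lia.
  have mge : 1 <= (leaves (prune t))%:R :> R by rewrite ler1n.
  have d0 : 0 <= 4 / s by rewrite divr_ge0// ltW.
  have E := stein_error_le ss s1 sw mge mle (stein_sol_le (std_pruned t) hBL)
    (stein_der_le _ hBL) (stein_sol_taylor (std_pruned t) hBL d0).
  rewrite (_ : h (std_pruned t) - gauss h = stein_der h (std_pruned t) -
     std_pruned t * stein_sol h (std_pruned t)).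
    by apply: le_trans E; rewrite le_eqVlt; apply/orP; left; apply/eqP;
      congr Num.norm; rewrite -/s ss; ring.
  by rewrite /stein_der addrK.
(* With second moment at most 6, the coefficient of [C] is [44 + 19 * 6 = 158]. *)
rewrite meanZ ler_pM2l ?exprn_gt0// meanD mean_cst; last by lia.
rewrite meanZ.
have := sqr_std_pruned_le n1; nra.
Qed.
End one_step_clt.

(** * Bounded-Lipschitz convergence and its propagation through pruning *)

Section convergence.
Variable R : realType.
Implicit Types (h : R -> R) (Y Z : btree -> R) (a s e : R) (n : nat).

(* Convergence to [N(0, s^2)] in the bounded-Lipschitz metric; the uniformity in
   [h] is what allows conditioning on a random number of leaves. *)
Definition cvg_normal Y s := forall e, 0 < e -> exists N : nat,
  forall n, (N <= n)%N -> forall h, BL h ->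
  `|mean n (h \o Y) - gauss (fun x => h (s * x))| <= e.

Lemma BL_affine h (L y b : R) : BL h -> 1 <= L -> `|b| <= L ->
  BL (fun x => L^-1 * h (y + b * x)).
Proof.
move=> [hb hl] L1 bL; have L0 : 0 < L by lra.
have Li : `|L^-1| = L^-1 by rewrite gtr0_norm// invr_gt0.
split=> [x|x z].
  by rewrite normrM Li mulrC ler_pdivrMr// mul1r (le_trans (hb _)).
rewrite -mulrBr normrM Li mulrC ler_pdivrMr// (le_trans (hl _ _))//.
have -> : y + b * x - (y + b * z) = b * (x - z) by ring.
by rewrite normrM mulrC ler_wpM2l.
Qed.

(** Dividing by [L] keeps the rescaled test function in [BL]; uniformity in [y] and [b] allows both
    to depend on the pruned size. *)
Lemma cvg_normal_affine Y s : cvg_normal Y s -> forall e L, 0 < e -> 1 <= L ->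
  exists N : nat, forall n, (N <= n)%N -> forall h (y b : R), BL h -> `|b| <= L ->
  `|mean n (fun t => h (y + b * Y t)) - gauss (fun x => h (y + b * s * x))| <= e.
Proof.
move=> Ys e L e0 L1; have L0 : 0 < L by lra.
have [|N HN] := Ys (e / L); first by rewrite divr_gt0.
exists N => n Nn h y b hBL bL.
have kBL := BL_affine y hBL L1 bL.
have := HN n Nn _ kBL; rewrite /comp meanZ.
have -> : gauss (fun x => L^-1 * h (y + b * (s * x))) =
    L^-1 * gauss (fun x => h (y + b * s * x)).
  rewrite /gauss -(@nmeanZ _ _ _ _ _ 1).
  - by congr nmean; apply/funext => x; rewrite mulrA.
  - by apply: comp_affine_continuous; exact: BL_continuous.
  - by move=> x; exact: BL_bound.
by rewrite -mulrBr normrM gtr0_norm ?invr_gt0// mulrC ler_pdivrMr// divfK// gt_eqF.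
Qed.

Lemma BL_dist_le2 h n (Y : btree -> R) s y : (0 < n)%N -> BL h ->
  `|mean n (fun t => h (Y t)) - gauss (fun x => h (y + s * x))| <= 2.
Proof.
move=> n0 hBL; rewrite (le_trans (ler_normB _ _))// (_ : 2 = 1 + 1)// lerD//.
  by rewrite (le_trans (ler_norm_mean _ _))// mean_le// => t _; exact: BL_bound.
apply: nmean_bound => [|x]; last exact: BL_bound.
by apply: comp_affine_continuous; exact: BL_continuous.
Qed.

(** Given [M], the first summand is constant and [Y] is nearly Gaussian, provided [M / n] is near
    [1 / 4]; Chebyshev handles the other event. The one-step theorem for the smoothed test function
    then leaves a convolution of two Gaussians. *)
Lemma cvg_normal_step Y Z a s (beta : R -> R) : 0 <= a -> 0 <= s ->
  0 <= beta 4^-1 ->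
  {for 4^-1, continuous beta} ->
  cvg_normal Y s ->
  (forall t, (1 < leaves t)%N -> Z t = a * std_pruned R t +
    beta ((leaves (prune t))%:R / (leaves t)%:R) * Y (prune t)) ->
  cvg_normal Z (Num.sqrt (a ^+ 2 + (beta 4^-1 * s) ^+ 2)).
Proof.
move=> a0 s0 b0 cb Ys ZE e e0; set b := beta 4^-1 in b0 *.
have E0 := gauss_abs_ge0 R; set E := gauss_abs R in E0.
pose K := 16 + 158 * stein_bound R.
have K0 : 0 <= K by have := stein_bound_ge0 R; rewrite /K; lra.
have [N1 HN1] := cvg_normal_affine Ys (e := e / 4) (L := b + 1)
  ltac:(lra) ltac:(lra).
pose e2 := Num.min 1 (e / (4 * (s * E + 1))).
have sE : 0 <= s * E by rewrite mulr_ge0.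
have e20 : 0 < e2.
  by rewrite lt_min ltr01 divr_gt0// mulr_gt0//; lra.
have e2E : e2 * (s * E) <= e / 4.
  have : e2 <= e / (4 * (s * E + 1)) by rewrite ge_min lexx orbT.
  rewrite ler_pdivlMr ?mulr_gt0//; last by lra.
  nra.
have e21 : e2 <= 1 by rewrite ge_min lexx orTb.
have [d d0 Hd] : exists2 d, 0 < d & forall x, `|4^-1 - x| <= d -> `|b - beta x| <= e2.
  move/cvgrPdist_le: cb => /(_ _ e20)[d /= d0 Hd].
  exists (d / 2); first by rewrite divr_gt0.
  move=> x xd; apply: Hd; rewrite /= (le_lt_trans xd)// ltr_pdivrMr//; lra.
pose d' := Num.min d 8^-1.
have d'0 : 0 < d' by rewrite lt_min d0 invr_gt0 ltr0n.
have d'd : d' <= d by rewrite ge_min lexx orTb.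
have d'8 : d' <= 8^-1 by rewrite ge_min lexx orbT.
(* The three thresholds ensure [N1 <= m] when [m >= n / 8], a Chebyshev term of at most [e / 4], and
   a one-step error of at most [e / 4]. *)
pose B := Num.max (8 * N1%:R) (Num.max (3 / (d' ^+ 2 * e)) ((4 * (1 + a) * K / e) ^+ 2)).
exists (maxn 2 (Num.bound B)) => n; rewrite geq_max => /andP[n1 nB] h hBL.
have n0 : 0 < n%:R :> R by rewrite ltr0n (ltnW n1).
have B0 : 0 <= B by rewrite le_max mulr_ge0.
have {}nB : B <= n%:R.
  by rewrite (le_trans (ltW (archi_boundP B0)))// ler_nat.
move: nB; rewrite !ge_max => /and3P[nB1 nB2 nB3].
set q := Num.sqrt (n%:R : R).
have q0 : 0 < q by rewrite sqrtr_gt0.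
have qq : n%:R = q ^+ 2 by rewrite sqr_sqrtr// ltW.
pose W := std_leaves R n.
pose H y := gauss (fun x => h (y + b * s * x)).
have HBL : BL H by exact: BL_gauss.
have -> : mean n (h \o Z) = mean n (fun t => mean (leaves (prune t))
    (fun u => h (a * W (leaves (prune t)) +
       beta ((leaves (prune t))%:R / n%:R) * Y u))).
  pose G u := h (a * W (leaves u) + beta ((leaves u)%:R / n%:R) * Y u).
  transitivity (mean n (fun t => G (prune t))).
    by apply: eq_mean => t tn /=; rewrite ZE ?tn// /std_pruned tn.
  rewrite mean_tower//; apply: eq_mean => t _; apply: eq_mean => u uE.
  by rewrite /G uE.
have P1 : `|mean n (fun t => mean (leaves (prune t))
    (fun u => h (a * W (leaves (prune t)) +
       beta ((leaves (prune t))%:R / n%:R) * Y u)))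
   - mean n (fun t => H (a * std_pruned R t))| <= e / 2 + e / 4.
  rewrite -meanB (le_trans (ler_norm_mean _ _))//.
  (* With this [c], [c * W m ^+ 2] is at least 2, the trivial bound, whenever [m / n] is further
     than [d'] from [1 / 4]. *)
  pose c := (8 * d' ^+ 2 * n%:R)^-1.
  have c0 : 0 <= c by rewrite invr_ge0 !mulr_ge0// ?sqr_ge0// ltW.
  apply: (@le_trans _ _ (mean n (fun t => e / 2 + c * std_pruned R t ^+ 2))).
    apply: ler_mean => t tn.
    have m0 := leaves_gt0 (prune t); set m := leaves (prune t) in m0 *.
    have -> : std_pruned R t = W m by rewrite /std_pruned tn.
    have Wm : W m = 4 * q * (m%:R / n%:R - 4^-1).
      by rewrite /W /std_leaves -/q qq; field; rewrite gt_eqF.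
    have [good|bad] := leP `|4^-1 - m%:R / n%:R| d'.
      have mN1 : (N1 <= m)%N.
        rewrite -(ler_nat R).
        have : 8^-1 <= m%:R / n%:R :> R by move: good; rewrite ler_norml => /andP[]; lra.
        by rewrite ler_pdivlMr//; lra.
      have Hb := Hd _ (le_trans good d'd).
      have bL : `|beta (m%:R / n%:R)| <= b + 1.
        by move: Hb; rewrite ler_norml => /andP[? ?]; rewrite ler_norml; apply/andP; split; lra.
      have A1 := HN1 m mN1 h (a * W m) _ hBL bL.
      have A2 := gauss_scale_lipschitz (a * W m) (beta (m%:R / n%:R) * s) (b * s) hBL.
      rewrite -mulrBl normrM (ger0_norm s0) -mulrA -/E [`|beta _ - b|]distrC in A2.
      have A3 : `|b - beta (m%:R / n%:R)| * (s * E) <= e / 4.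
        by rewrite (le_trans _ e2E)// ler_wpM2r.
      rewrite -[X in X <= _]/`|_ - gauss (fun x => h (a * W m + b * s * x))|.
      rewrite (le_trans (ler_distD (gauss (fun x => h (a * W m + beta (m%:R / n%:R) * s * x))) _ _))//.
      have : 0 <= c * W m ^+ 2 by rewrite mulr_ge0 ?sqr_ge0.
      by lra.
    rewrite (le_trans (BL_dist_le2 _ _ _ m0 hBL))//.
    have : 2 <= c * W m ^+ 2; last by lra.
    rewrite mulrC ler_pdivlMr; last by rewrite !mulr_gt0 ?exprn_gt0.
    rewrite Wm exprMn exprMn -qq.
    have : d' ^+ 2 <= (m%:R / n%:R - 4^-1) ^+ 2.
      rewrite -[leRHS]real_normK ?num_real// distrC lerXn2r// ?nnegrE// ltW//.
    by move=> ?; nra.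
  rewrite meanD mean_cst; last exact: ltnW.
  rewrite meanZ lerD2l.
  apply: (@le_trans _ _ (c * 6)); first by rewrite ler_wpM2l// sqr_std_pruned_le.
  rewrite mulrC ler_pdivrMr; last by rewrite !mulr_gt0 ?exprn_gt0.
  move: nB2; rewrite ler_pdivrMr ?mulr_gt0 ?exprn_gt0//.
  lra.
have P2 : `|mean n (fun t => H (a * std_pruned R t)) -
    gauss (fun x => H (a * x))| <= e / 4.
  have L1 : 1 <= 1 + a by lra.
  have aL : `|a| <= 1 + a by rewrite ger0_norm//; lra.
  have := std_pruned_clt n1 (BL_affine 0 HBL L1 aL); rewrite -/K -/q meanZ.
  rewrite /gauss (@nmeanZ _ _ _ _ _ 1); last first.
  - by move=> x; exact: BL_bound.
  - by apply: comp_affine_continuous; exact: BL_continuous.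
  rewrite -mulrBr normrM gtr0_norm ?invr_gt0; last by lra.
  rewrite mulrC ler_pdivrMr; last by lra.
  under [X in `|X - _|]eq_mean do rewrite add0r.
  rewrite (_ : (fun x : R => H (0 + a * x)) = fun x => H (a * x)); last first.
    by apply/funext => x; rewrite add0r.
  move=> /le_trans; apply; rewrite mulrAC ler_pdivrMr//.
  move: nB3; rewrite qq.
  have X0 : 0 <= 4 * (1 + a) * K / e.
    by rewrite divr_ge0 ?(ltW e0)// mulr_ge0// mulr_ge0//; lra.
  rewrite ler_sqr ?nnegrE ?(ltW q0)// ler_pdivrMr//.
  lra.
rewrite -gauss_conv// ?mulr_ge0//.
rewrite (le_trans (ler_distD (mean n (fun t => H (a * std_pruned R t))) _ _))//.
have -> : (fun x => gauss (fun y => h (a * x + b * s * y))) = fun x => H (a * x) by [].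
by lra.
Qed.
End convergence.

(** * Branch ratios and the variance recursion *)

Section branch_ratio_clt.
Variable R : realType.
Implicit Types (t : btree) (q r n : nat).

(** Scaling by [leaves t] instead of a fixed [n] gives the pruned tree its own normalisation. *)
Definition scaled_ratio q r t : R :=
  Num.sqrt (leaves t)%:R * (branch_ratio q r t - (4 ^+ r)^-1).

(** The limiting variance for order [q.+1]: the index counts the prunings that reduce to order 1. *)
Definition ratio_var q r : R := (4 ^+ r - 1) / (3 * 16 ^+ r) * 4 ^+ q.

Lemma branch_ratio_prune q r t : (0 < q)%N -> (1 < leaves t)%N ->
  branch_ratio q.+1 r t = branch_ratio q r (prune t) :> R.
Proof.
move=> q0 t1; have lt : ~~ is_leaf t by rewrite is_leafE; lia.
by rewrite /branch_ratio addSn !nbranchesS// addn_gt0 q0.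
Qed.

Lemma branch_ratio1 r t :
  branch_ratio 1 r t = (nbranches r.+1 t)%:R / (leaves t)%:R :> R.
Proof.
by rewrite /branch_ratio nbranches1 add1n; case: eqP => // t0; have := leaves_gt0 t; lia.
Qed.

Lemma scaled_ratio10 t : scaled_ratio 1 0 t = 0.
Proof.
rewrite /scaled_ratio branch_ratio1 nbranches1 divff ?expr0 ?invr1 ?subrr ?mulr0//.
by rewrite pnatr_eq0; have := leaves_gt0 t; lia.
Qed.

Lemma scaled_ratio1S r t : (1 < leaves t)%N ->
  scaled_ratio 1 r.+1 t = (4 ^+ r.+1)^-1 * std_pruned R t +
    Num.sqrt ((leaves (prune t))%:R / (leaves t)%:R) * scaled_ratio 1 r (prune t).
Proof.
move=> t1; have lt : ~~ is_leaf t by rewrite is_leafE; lia.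
rewrite /scaled_ratio !branch_ratio1 nbranchesS// /std_pruned /std_leaves.
have n0 : 0 < (leaves t)%:R :> R by rewrite ltr0n; lia.
have m0 : 0 < (leaves (prune t))%:R :> R by rewrite ltr0n leaves_gt0.
move: (nbranches _ _)%:R => k.
set n := (leaves t)%:R in n0 *; set m := (leaves (prune t))%:R in m0 *.
rewrite sqrtrM ?(ltW m0)// sqrtrV ?(ltW n0)//.
have sn : 0 < Num.sqrt n by rewrite sqrtr_gt0.
have nE : n = Num.sqrt n ^+ 2 by rewrite sqr_sqrtr// ltW.
have mE : Num.sqrt m * Num.sqrt m = m by rewrite -expr2 sqr_sqrtr// ltW.
have -> : Num.sqrt m / Num.sqrt n * (Num.sqrt m * (k / m - (4 ^+ r)^-1)) =
   (Num.sqrt m * Num.sqrt m) / Num.sqrt n * (k / m - (4 ^+ r)^-1) by ring.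
rewrite mE exprS; move: nE sn; set s := Num.sqrt n => nE sn; rewrite nE.
have : (4 : R) ^+ r != 0 by rewrite expf_neq0.
move: (4 ^+ r) => p p0; field.
by rewrite p0 (gt_eqF sn) (gt_eqF m0).
Qed.

Lemma scaled_ratioS q r t : (0 < q)%N -> (1 < leaves t)%N ->
  scaled_ratio q.+1 r t = 0 * std_pruned R t +
    Num.sqrt ((leaves (prune t))%:R / (leaves t)%:R)^-1 * scaled_ratio q r (prune t).
Proof.
move=> q0 t1; rewrite mul0r add0r /scaled_ratio branch_ratio_prune// mulrA.
have m0 : 0 < (leaves (prune t))%:R :> R by rewrite ltr0n leaves_gt0.
congr (_ * _); rewrite invf_div sqrtrM// sqrtrV ?(ltW m0)// divfK//.
by rewrite gt_eqF// sqrtr_gt0.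
Qed.

Lemma ratio_var_ge0 q r : 0 <= ratio_var q r.
Proof.
by rewrite mulr_ge0 ?exprn_ge0// divr_ge0 ?mulr_ge0 ?exprn_ge0// subr_ge0 exprn_ege1// ler1n.
Qed.

(** The variances satisfy [v_(r+1) = 16^-(r+1) + v_r / 4], the factor [1 / 4] being the limit of
    [M / n]; at [r = 0] the statistic is identically 0. *)
Lemma cvg_normal_ratio1 r :
  cvg_normal (scaled_ratio 1 r) (Num.sqrt (ratio_var 0 r)).
Proof.
elim: r => [|r IH].
  move=> e e0; exists 1%N => n n0 h hBL.
  have -> : ratio_var 0 0 = 0 by rewrite /ratio_var subrr !mul0r.
  rewrite sqrtr0 (@eq_mean _ _ _ (fun=> h 0)) => [|t _ /=].
    rewrite mean_cst// (_ : (fun x => h (0 * x)) = fun=> h 0).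
      by rewrite /gauss nmean_cst subrr normr0 ltW.
    by apply/funext => x; rewrite mul0r.
  by rewrite scaled_ratio10.
have q4 : Num.sqrt (4^-1 : R) = 2^-1.
  by rewrite (_ : 4^-1 = 2^-1 ^+ 2) ?sqrtr_sqr ?ger0_norm ?invr_ge0//; field.
have -> : Num.sqrt (ratio_var 0 r.+1) = Num.sqrt ((4 ^+ r.+1)^-1 ^+ 2 +
    (Num.sqrt 4^-1 * Num.sqrt (ratio_var 0 r)) ^+ 2).
  rewrite exprMn [Num.sqrt (ratio_var 0 r) ^+ 2]sqr_sqrtr ?ratio_var_ge0// q4.
  congr Num.sqrt; rewrite /ratio_var !exprS.
  have -> : (16 : R) = 4 ^+ 2 by ring.
  rewrite -exprM mulnC exprM.
  have : (4 : R) ^+ r != 0 by rewrite expf_neq0.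
  by move: (4 ^+ r) => p p0; field; rewrite p0.
apply: (@cvg_normal_step R (scaled_ratio 1 r)) => //.
- exact: sqrt_continuous.
- by move=> t t1; exact: scaled_ratio1S.
Qed.

Lemma cvg_normal_ratio q r :
  cvg_normal (scaled_ratio q.+1 r) (Num.sqrt (ratio_var q r)).
Proof.
elim: q => [|q IH]; first exact: cvg_normal_ratio1.
have q4 : Num.sqrt (4^-1^-1 : R) = 2.
  by rewrite invrK (_ : 4 = 2 ^+ 2) ?sqrtr_sqr ?ger0_norm//; ring.
have -> : Num.sqrt (ratio_var q.+1 r) = Num.sqrt (0 ^+ 2 +
    (Num.sqrt 4^-1^-1 * Num.sqrt (ratio_var q r)) ^+ 2).
  rewrite exprMn [Num.sqrt (ratio_var q r) ^+ 2]sqr_sqrtr ?ratio_var_ge0// q4.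
  by congr Num.sqrt; rewrite /ratio_var exprS; ring.
(* With [a = 0] no fresh Gaussian enters; the factor [sqrt (n / M)] tends to 2 and multiplies the
   variance by 4. *)
apply: (@cvg_normal_step R (scaled_ratio q.+1 r) _ _ _
  (fun x => Num.sqrt x^-1)) => //.
- apply: (@continuous_comp _ _ _ (fun x : R => x^-1) Num.sqrt).
    by apply: cvgV => //; exact: cvg_id.
  exact: sqrt_continuous.
- by move=> t t1; exact: scaled_ratioS.
Qed.
End branch_ratio_clt.

(** * From Lipschitz test functions to distribution functions *)

Section cdf.
Variable R : realType.
Implicit Types (s x y z e : R) (Y : btree -> R).
Notation mu := (@lebesgue_measure R).

Definition normal_cdf s z : R := \int[mu]_(t in `]-oo, z]) normal_pdf 0 s t.

Lemma normal_probE s z : normal_prob 0 s `]-oo, z] = (normal_cdf s z)%:E.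
Proof.
rewrite /normal_cdf /Rintegral fineK//; apply: integrable_fin_num => //.
by apply: (integrableS measurableT) => //; exact: integrable_normal_pdf.
Qed.

Lemma normal_cdfD_le s z e : s != 0 -> 0 < e ->
  normal_cdf s (z + e) <= normal_cdf s z + normal_peak s * e.
Proof.
move=> s0 e0.
have muE : mu (`]z, (z + e)%R]%classic : set R) = e%:E.
  rewrite lebesgue_measure_itv /= lte_fin ltrDl e0 -EFinB.
  by congr EFin; ring.
rewrite -lerBlDl /normal_cdf Rintegral_itvB.
- rewrite (_ : normal_peak s * e = \int[mu]_(t in `]z, z + e]) normal_peak s).
    apply: le_Rintegral => //.
    + by apply: (integrableS measurableT) => //; exact: integrable_normal_pdf.
    + apply: (@integrableS _ _ _ mu `[z, (z + e)%R]) => //.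
        exact: subset_itv_oc_cc.
      apply: continuous_compact_integrable; first exact: segment_compact.
      by apply: continuous_subspaceT => t; exact: cvg_cst.
    + by move=> t _; exact: normal_pdf_ub.
  rewrite Rintegral_cst//; congr (_ * _).
  by rewrite -[LHS]/(fine e%:E); congr fine; exact/esym/muE.
- by apply: (integrableS measurableT) => //; exact: integrable_normal_pdf.
- by [].
- by rewrite bnd_simp lerDl ltW.
Qed.

(** A piecewise linear substitute for the indicator of [y <= z], scaled by [e] so that its slope
    stays at most 1. *)
Definition ramp z e y := Num.max 0 (Num.min e (z + e - y)).

Lemma ramp_BL z e : 0 < e -> e <= 1 -> BL (ramp z e).
Proof.
move=> e0 e1; split=> [x|x y].
  rewrite /ramp ger0_norm; last by rewrite le_max lexx.
  by rewrite ge_max ler01 ge_min e1.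
rewrite /ramp /Num.max /Num.min; do 4 case: ifPn; rewrite -?leNgt => *;
  rewrite ler_norml; apply/andP; split; try lra;
  have := ler_norm (x - y); have := ler_norm (y - x); rewrite distrC; lra.
Qed.

Lemma ramp_lb z e y : 0 < e -> e * (y <= z)%R%:R <= ramp z e y.
Proof.
move=> e0; rewrite /ramp le_max le_min; case: (leP y z) => yz /=.
  by rewrite mulr1 lexx /=; apply/orP; right; lra.
by rewrite mulr0 lexx.
Qed.

Lemma ramp_ub z e y : 0 < e -> ramp z e y <= e * (y <= z + e)%R%:R.
Proof.
move=> e0; rewrite /ramp ge_max ge_min; case: (leP y (z + e)) => yz /=.
  by rewrite mulr1 lexx (ltW e0).
by rewrite mulr0 lexx /=; apply/orP; right; lra.
Qed.

Lemma mulr_cdfE s z e :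
  e * normal_cdf s z = \int[mu]_t ((fun t => e * normal_pdf 0 s t) \_ `]-oo, z]) t.
Proof.
rewrite -Rintegral_mkcond /normal_cdf RintegralZl//.
by apply: (integrableS measurableT) => //; exact: integrable_normal_pdf.
Qed.

Lemma integrable_restrict_pdf s z e : mu.-integrable setT
  (EFin \o ((fun t => e * normal_pdf 0 s t) \_ `]-oo, z])).
Proof.
have ce : continuous (fun _ : R => e) by move=> x; exact: cvg_cst.
have H := @integrable_nmean R 0 s `|e| _ ce (fun=> lexx _).
rewrite -restrict_EFin; apply: (integrable_mkcond _ _).1 => //.
exact: (integrableS measurableT) H.
Qed.

Lemma nmean_ramp_le s z e : 0 < e -> e <= 1 ->
  nmean 0 s (ramp z e) <= e * normal_cdf s (z + e).
Proof.
move=> e0 e1; have rBL := ramp_BL z e0 e1.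
rewrite mulr_cdfE; apply: le_Rintegral => //.
- by apply: (@integrable_nmean _ _ _ 1) => [|x]; [exact: BL_continuous|exact: BL_bound].
- exact: integrable_restrict_pdf.
- have key (t : R) : ramp z e t * normal_pdf 0 s t <=
      if t <= z + e then e * normal_pdf 0 s t else 0.
    have := ramp_ub z t e0; case: ifP => _; rewrite ?mulr1 ?mulr0 => H.
      by rewrite ler_wpM2r// normal_pdf_ge0.
    by rewrite mulr_le0_ge0// normal_pdf_ge0.
  by move=> t _; rewrite patchE mem_setE in_itv /=; exact: key.
Qed.

Lemma nmean_ramp_ge s z e : 0 < e -> e <= 1 ->
  e * normal_cdf s z <= nmean 0 s (ramp z e).
Proof.
move=> e0 e1; have rBL := ramp_BL z e0 e1.
rewrite mulr_cdfE; apply: le_Rintegral => //.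
- exact: integrable_restrict_pdf.
- by apply: (@integrable_nmean _ _ _ 1) => [|x]; [exact: BL_continuous|exact: BL_bound].
- have key (t : R) : (if t <= z then e * normal_pdf 0 s t else 0) <=
      ramp z e t * normal_pdf 0 s t.
    have := ramp_lb z t e0; case: ifP => _; rewrite ?mulr1 ?mulr0 => H.
      by rewrite ler_wpM2r// normal_pdf_ge0.
    by rewrite mulr_ge0// normal_pdf_ge0.
  by move=> t _; rewrite patchE mem_setE in_itv /=; exact: key.
Qed.

Lemma cvg_normal_cdf Y s x : 0 < s -> cvg_normal Y s ->
  (fun n => mean n (fun t => (Y t <= x)%R%:R)) @ \oo --> normal_cdf s x.
Proof.
move=> s0 Ys; apply/cvgrPdist_le => d d0.
have p0 : 0 <= normal_peak s by exact: normal_peak_ge0.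
pose e := Num.min 1 (d / (normal_peak s + 1)).
have e0 : 0 < e by rewrite lt_min ltr01 divr_gt0//; lra.
have e1 : e <= 1 by rewrite ge_min lexx orTb.
have ed : (normal_peak s + 1) * e <= d.
  have : e <= d / (normal_peak s + 1) by rewrite ge_min lexx orbT.
  by rewrite ler_pdivlMr ?(mulrC e)//; lra.
(* Ramps carry a factor [e], so accuracy [e ^+ 2] becomes [e] after division; the sandwich between
   two ramps costs a further [normal_peak s * e]. *)
have [N HN] := Ys (e ^+ 2) (exprn_gt0 2 e0).
exists N => // n /= Nn.
have gaussE z : gauss (fun y => ramp z e (s * y)) = nmean 0 s (ramp z e).
  rewrite (@nmean_affine _ _ _ _ 1)//.
  - by congr nmean; apply/funext => y; rewrite add0r.
  - by apply: BL_continuous; exact: ramp_BL.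
  - by move=> y; apply: BL_bound; exact: ramp_BL.
have H1 := HN n Nn _ (ramp_BL x e0 e1); rewrite gaussE in H1.
have H2 := HN n Nn _ (ramp_BL (x - e) e0 e1); rewrite gaussE in H2.
set P := mean n _.
have U : e * P <= mean n (ramp x e \o Y).
  by rewrite -meanZ; apply: ler_mean => t _; exact: ramp_lb.
have L : mean n (ramp (x - e) e \o Y) <= e * P.
  rewrite -meanZ; apply: ler_mean => t _ /=.
  by have := ramp_ub (x - e) (Y t) e0; rewrite subrK.
have G1 := nmean_ramp_le s x e0 e1.
have G2 := nmean_ramp_ge s (x - e) e0 e1.
have C1 := normal_cdfD_le x (lt0r_neq0 s0) e0.
have C2 := normal_cdfD_le (x - e) (lt0r_neq0 s0) e0; rewrite subrK in C2.
have {}C1 : e * normal_cdf s (x + e) <= e * (normal_cdf s x + normal_peak s * e).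
  by rewrite ler_pM2l.
have {}C2 : e * (normal_cdf s x - normal_peak s * e) <= e * normal_cdf s (x - e).
  by rewrite ler_pM2l// lerBlDr.
move: H1; rewrite ler_norml => /andP[_ H1].
move: H2; rewrite ler_norml => /andP[H2 _].
rewrite (le_trans _ ed)// ler_norml; apply/andP; split; rewrite -(ler_pM2l e0).
  by lra.
by lra.
Qed.
End cdf.

(** * Translation to the stated probabilities and variance *)

Lemma unifPE (R : realType) n (E : pred btree) :
  unifP n E = mean n (fun t => (E t)%:R) :> R.
Proof. by rewrite /unifP /mean -natr_sum -sumn_count sumnE big_map. Qed.

Lemma ratio_varE (R : realType) q r :
  ratio_var R q r = (4 ^+ r - 1) / (3 * (4 : R) ^ ((2 * r)%N%:Z - q.+1%:Z + 1)).
Proof.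
have -> : (2 * r)%N%:Z - q.+1%:Z + 1 = (2 * r)%N%:Z - q%:Z by lia.
rewrite expfzDr ?pnatr_eq0// -exprnN -exprnP exprM (_ : 4 ^+ 2 = 16); last by ring.
rewrite /ratio_var -mulrA; congr (_ * _).
by rewrite [in RHS]mulrA [in RHS]invfM invrK.
Qed.

Lemma ratio_var_gt0 (R : realType) q r : (0 < r)%N -> 0 < ratio_var R q r.
Proof.
move=> r0; rewrite mulr_gt0 ?exprn_gt0// divr_gt0 ?mulr_gt0 ?exprn_gt0//.
by rewrite subr_gt0 exprn_egt1 ?ltr1n// -lt0n.
Qed.

(* Convergence in distribution to N(0, v): for every real x (all points are
   continuity points of the normal cdf since v > 0),
   P_n( sqrt n * (S_{q+r,n}/S_{q,n} - 4^-r) <= x ) --> N(0,v)(]-oo, x]).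
   normal_prob m s takes the standard deviation s = sqrt v. *)
Theorem theorem4 (R : realType) (q r : nat) :
  (1 <= q)%N -> (1 <= r)%N ->
  let v : R := (4 ^+ r - 1) / (3 * (4 : R) ^ ((2 * r)%N%:Z - q%:Z + 1)) in
  forall x : R,
    (fun n : nat =>
       (unifP n (fun t => Num.sqrt (n%:R : R) * (branch_ratio q r t - (4 ^+ r)^-1) <= x))%:E)
      @ \oo --> normal_prob 0 (Num.sqrt v) `]-oo, x].
Proof.
case: q => // q _ r0 v x.
have -> : v = ratio_var R q r by rewrite ratio_varE.
rewrite normal_probE.
have s0 : 0 < Num.sqrt (ratio_var R q r) by rewrite sqrtr_gt0 ratio_var_gt0.
have := cvg_normal_cdf (x := x) s0 (@cvg_normal_ratio R q r).
under eq_cvg => n.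
  rewrite (_ : mean n _ = unifP n (fun t => Num.sqrt (n%:R : R) *
    (branch_ratio q.+1 r t - (4 ^+ r)^-1) <= x)).
    over.
  by rewrite unifPE; apply: eq_mean => t tn; rewrite /scaled_ratio tn.
move=> H; apply: cvg_EFin; last exact: H.
exact: nearW.
Qed.
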